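(* Let $M$ be a complete MV-algebra and $N$ a semisimple MV-algebra such that $\operatorname{Max}N$ is metrisable. For every probability map $p\colon M\to N$ there is a $C_{\mathbb{R}}(\operatorname{Max}N)$-valued regular vector measure $\vec{\mu}$ on the Borel sets of $\operatorname{Max}M$ such that \[ p(a)^{*}=\int_{\operatorname{Max}M} a^{*}\,\mathrm{d}\vec{\mu}\qquad\text{for all } a\in M. \]
   Context: For an MV-algebra $(M,\oplus,\neg,0)$: $1\coloneqq\neg 0$, $a\vee b\coloneqq\neg(\neg a\oplus b)\oplus b$, $a\wedge b\coloneqq\neg(\neg a\vee\neg b)$; $M$ is complete if its lattice order is complete. A probability map is a function $p\colon M\to N$ between MV-algebras such that for all $a,b\in M$: (P1) $p(a\oplus b)=p(a)\oplus p(b\wedge\neg a)$; (P2) $p(\neg a)=\neg p(a)$; (P3) $p(1)=1$. $\operatorname{Max}M$ is the compact Hausdorff space of maximal ideals of $M$; for $\mathfrak{m}\in\operatorname{Max}M$ let $h_{\mathfrak{m}}$ be the unique MV-isomorphism of $M/\mathfrak{m}$ onto a subalgebra of $[0,1]$, and $a^*(\mathfrak{m})\coloneqq h_{\mathfrak{m}}(a/\mathfrak{m})$, a continuous function. $N$ is semisimple if the intersection of its maximal ideals is $\{0\}$. For compact Hausdorff $X,Y$, a vector measure is a map $\vec\mu$ from the Borel sets of $X$ to the Banach space $C_{\mathbb{R}}(Y)$ (sup norm) that is countably additive with norm-convergent sums; it is regular if for every Borel $A$ and $\epsilon>0$ there are compact $K$ and open $O$ with $K\subseteq A\subseteq O$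 and semivariation $\|\vec\mu\|(O\setminus K)<\epsilon$, where $\|\vec\mu\|(E)=\sup\{|x^*\circ\vec\mu|(E): x^*\in C_{\mathbb{R}}(Y)^*,\ \|x^*\|\le 1\}$. The integral $\int_X a\,\mathrm{d}\vec\mu$ of $a\in C_{\mathbb{R}}(X)$ is defined as the limit of integrals of uniformly approximating simple functions (Bartle–Dunford–Schwartz integral). *)

(* Defs.v *)
From HB Require Import structures.
From mathcomp Require Import all_boot all_order all_algebra.
From mathcomp Require Import all_classical all_reals.
From mathcomp Require Import topology normedtype ereal measure.
Set Implicit Arguments. Unset Strict Implicit. Unset Printing Implicit Defensive.
Import Order.TTheory GRing.Theory Num.Theory.
Import numFieldNormedType.Exports.
Local Open Scope classical_set_scope.
Local Open Scope ring_scope.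

Record mvalg := MVAlg {
  mv_car :> Type;
  mv_oplus : mv_car -> mv_car -> mv_car;
  mv_neg : mv_car -> mv_car;
  mv_zero : mv_car;
  mv_oplusA : forall x y z, mv_oplus (mv_oplus x y) z = mv_oplus x (mv_oplus y z);
  mv_oplusC : forall x y, mv_oplus x y = mv_oplus y x;
  mv_oplus0 : forall x, mv_oplus x mv_zero = x;
  mv_negK : forall x, mv_neg (mv_neg x) = x;
  mv_oplus1 : forall x, mv_oplus x (mv_neg mv_zero) = mv_neg mv_zero;
  mv_luk : forall x y, mv_oplus (mv_neg (mv_oplus (mv_neg x) y)) y
                     = mv_oplus (mv_neg (mv_oplus (mv_neg y) x)) x }.

Definition mv_one (M : mvalg) : M := mv_neg (mv_zero M).
Definition mv_join (M : mvalg) (a b : M) : M :=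
  mv_oplus (mv_neg (mv_oplus (mv_neg a) b)) b.
Definition mv_meet (M : mvalg) (a b : M) : M :=
  mv_neg (mv_join (mv_neg a) (mv_neg b)).
Definition mv_le (M : mvalg) (a b : M) : Prop := mv_join a b = b.

Definition mv_complete (M : mvalg) : Prop :=
  forall S : set M, exists s : M,
    (forall x, S x -> mv_le x s) /\ (forall u, (forall x, S x -> mv_le x u) -> mv_le s u).

Definition probability_map (M N : mvalg) (p : M -> N) : Prop :=
  [/\ forall a b, p (mv_oplus a b) = mv_oplus (p a) (p (mv_meet b (mv_neg a))),
      forall a, p (mv_neg a) = mv_neg (p a) &
      p (mv_one M) = mv_one N].

Definition mv_ideal (M : mvalg) (I : set M) : Prop :=
  [/\ I (mv_zero M),
      forall x y, mv_le x y -> I y -> I x &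
      forall x y, I x -> I y -> I (mv_oplus x y)].

Definition mv_maximal (M : mvalg) (I : set M) : Prop :=
  [/\ mv_ideal I, I <> setT &
      forall J : set M, mv_ideal J -> I `<=` J -> J = I \/ J = setT].

Definition MaxSpec (M : mvalg) := {m : set M | mv_maximal m}.

Definition mv_semisimple (M : mvalg) : Prop :=
  [set x : M | forall m : MaxSpec M, proj1_sig m x] = [set mv_zero M].

Definition max_open (M : mvalg) (U : set (MaxSpec M)) : Prop :=
  exists S : set M, U = [set m | exists2 s, S s & ~ proj1_sig m s].

Definition max_compact (M : mvalg) (K : set (MaxSpec M)) : Prop :=
  forall (I : Type) (O : I -> set (MaxSpec M)),
    (forall i, max_open (O i)) -> K `<=` \bigcup_i O i ->
    exists2 D : set I, finite_set D & K `<=` \bigcup_(i in D) O i.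

Definition max_borel (M : mvalg) : set (set (MaxSpec M)) :=
  smallest (sigma_algebra setT) (@max_open M).

Definition max_metrisable (R : realType) (M : mvalg) : Prop :=
  exists d : MaxSpec M -> MaxSpec M -> R,
    [/\ forall x y, 0 <= d x y, forall x y, d x y = 0 <-> x = y,
        forall x y, d x y = d y x,
        forall x y z, d x z <= d x y + d y z &
        forall U : set (MaxSpec M), max_open U <->
          (forall x, U x -> exists2 r : R, 0 < r & [set y | d x y < r] `<=` U)].

Definition mvhom01 (R : realType) (M : mvalg) (h : M -> R) : Prop :=
  [/\ forall x, 0 <= h x <= 1,
      forall x y, h (mv_oplus x y) = Num.min 1 (h x + h y),
      forall x, h (mv_neg x) = 1 - h x &
      h (mv_zero M) = 0].

(* a^*(m) = h_m(a/m): h_m o (quotient by m) is the (unique) MV-homomorphism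
   M -> [0,1] whose kernel is m; we take its value at a. *)
Definition mvstar (R : realType) (M : mvalg) (a : M) (m : MaxSpec M) : R :=
  xget 0 [set r : R | exists h : M -> R,
            [/\ mvhom01 h, forall x, h x = 0 <-> proj1_sig m x & h a = r]].

Definition max_continuous (R : realType) (M : mvalg) (f : MaxSpec M -> R) : Prop :=
  forall V : set R, open V -> max_open (f @^-1` V).

Definition unif_cvg (R : realType) (Y : Type) (f : nat -> Y -> R) (g : Y -> R) : Prop :=
  forall e : R, 0 < e -> exists N : nat, forall n, (N <= n)%N -> forall y, `|f n y - g y| <= e.

Definition vector_measure (R : realType) (M N : mvalg)
    (mu : set (MaxSpec M) -> MaxSpec N -> R) : Prop :=
  (forall A, max_borel A -> max_continuous (mu A)) /\
  (forall A : nat -> set (MaxSpec M), (forall n, max_borel (A n)) ->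
     trivIset setT A ->
     unif_cvg (fun n y => \sum_(k < n) mu (A k) y) (mu (\bigcup_k A k))).

Definition dual_unit_ball (R : realType) (N : mvalg) (x : (MaxSpec N -> R) -> R) : Prop :=
  [/\ forall f g, max_continuous f -> max_continuous g -> x (f \+ g) = x f + x g,
      forall c f, max_continuous f -> x (fun y => c * f y) = c * x f &
      forall f (c : R), max_continuous f -> (forall y, `|f y| <= c) -> `|x f| <= c].

Definition borel_partition (M : mvalg) (E : set (MaxSpec M)) (n : nat)
    (F : nat -> set (MaxSpec M)) : Prop :=
  [/\ forall i, (i < n)%N -> max_borel (F i),
      trivIset [set i | (i < n)%N] F &
      \bigcup_(i in [set i | (i < n)%N]) F i = E].

Definition total_variation (R : realType) (M : mvalg) (nu : set (MaxSpec M) -> R)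
    (E : set (MaxSpec M)) : \bar R :=
  ereal_sup [set r : \bar R | exists (n : nat) (F : nat -> set (MaxSpec M)),
                  borel_partition E n F /\ r = ((\sum_(i < n) `|nu (F i)|)%:E)%E].

Definition semivariation (R : realType) (M N : mvalg)
    (mu : set (MaxSpec M) -> MaxSpec N -> R) (E : set (MaxSpec M)) : \bar R :=
  ereal_sup [set r : \bar R | exists x : (MaxSpec N -> R) -> R,
                  dual_unit_ball x /\ r = total_variation (fun A => x (mu A)) E].

Definition regular_vm (R : realType) (M N : mvalg)
    (mu : set (MaxSpec M) -> MaxSpec N -> R) : Prop :=
  forall (A : set (MaxSpec M)) (e : R), max_borel A -> 0 < e ->
    exists K O : set (MaxSpec M),
      [/\ max_compact K, max_open O, K `<=` A, A `<=` O &
          (semivariation mu (O `\` K) < e%:E)%E].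

Definition simple_fun (M : mvalg) (R : realType) (n : nat) (c : nat -> R)
    (A : nat -> set (MaxSpec M)) : MaxSpec M -> R :=
  fun m => \sum_(i < n) (if `[< A i m >] then c i else 0).

Definition simple_approx (R : realType) (M : mvalg) (f : MaxSpec M -> R)
    (n : nat -> nat) (c : nat -> nat -> R) (A : nat -> nat -> set (MaxSpec M)) : Prop :=
  [/\ forall k i, (i < n k)%N -> max_borel (A k i),
      forall k, trivIset [set i | (i < n k)%N] (A k) &
      unif_cvg (fun k => simple_fun (n k) (c k) (A k)) f].

Definition simple_integral (R : realType) (M N : mvalg)
    (mu : set (MaxSpec M) -> MaxSpec N -> R) (n : nat) (c : nat -> R)
    (A : nat -> set (MaxSpec M)) : MaxSpec N -> R :=
  fun y => \sum_(i < n) c i * mu (A i) y.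

(* Bartle-Dunford-Schwartz integral: v = \int f dmu, i.e. v is the (norm) limit
   of the integrals of (every) sequence of simple functions converging uniformly
   to f, such sequences existing. *)
Definition is_vm_integral (R : realType) (M N : mvalg)
    (mu : set (MaxSpec M) -> MaxSpec N -> R) (f : MaxSpec M -> R)
    (v : MaxSpec N -> R) : Prop :=
  (exists n c A, simple_approx f n c A) /\
  (forall n c A, simple_approx f n c A ->
     unif_cvg (fun k => simple_integral mu (n k) (c k) (A k)) v).

(* Main.v *)
Require Import Defs.
From mathcomp Require Import all_boot all_order all_algebra.
From mathcomp Require Import all_classical all_reals.
From mathcomp Require Import topology normedtype ereal measure.
From mathcomp Require Import lra zify.
Set Implicit Arguments. Unset Strict Implicit. Unset Printing Implicit Defensive.
Import Order.TTheory GRing.Theory Num.Theory.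
Import numFieldNormedType.Exports.
(* mathcomp-analysis has another constant named [max_continuous]. *)
Import Defs.
Local Open Scope classical_set_scope.
Local Open Scope ring_scope.

(* Each y in Max N gives a state s_y(a) = p(a)^*(y) on M. As M is complete,
   Max M is extremally disconnected, with a base of clopens indexed by the
   Boolean elements of M, and the suprema of arbitrary families of Booleans
   exist. If the s_y were not uniformly exhaustive on the clopen subsets of some
   open set, there would be disjoint Booleans b_k and points y_k with
   s_{y_k}(b_k) > e; since Max N is metrisable, y_k may be assumed to converge,
   and then the values s_{y_k}(sup_{i in S} b_i), which converge for every set S
   of indices, contradict Rosenthal's lemma (this is Grothendieck's theorem that
   operators from C(Max M) to a separable space are weakly compact, for positive
   operators). Hence every Borel set is, uniformly in y, the limit of clopen sets
   for the submeasure sup_y s_y, and b |-> s_y(b) extends to Borel sets by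
   uniform continuity; uniform limits make the result C(Max N)-valued, countably
   additive in norm and regular. The integral formula follows from the binary
   expansion of a^* by Boolean elements. That a^* is a homomorphism is Hoelder's
   theorem for simple MV-algebras. *)

(** * MV-algebras *)

(** A representing measure for each s_y separately would carry no uniformity in y, which is what
    continuity of the values, norm-convergent sums and regularity ask for. So all y are handled at
    once through one notion of size, [small]. Its countable subadditivity comes from finite
    subadditivity and compactness alone; exhaustivity enters only when an open set is approximated
    by a clopen one and when the tail of a countable union is estimated. A probability map need not
    preserve infinite suprema, so s_y of a supremum of disjoint Booleans may exceed the sum of the
    values. Only finite superadditivity over sets of indices is available, and this is the setting
    of Rosenthal's lemma. Since the measure takes nonnegative values, its semivariation on a set is
    bounded by the supremum over y of the measure of that set; regularity is therefore the same
    smallness statement as approximability by clopens. *)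

Definition mv_odot (M : mvalg) (a b : M) : M :=
  mv_neg (mv_oplus (mv_neg a) (mv_neg b)).

Fixpoint mv_muln (M : mvalg) (n : nat) (a : M) : M :=
  if n is k.+1 then mv_oplus a (mv_muln k a) else mv_zero M.

Local Notation "a ⊕ b" := (mv_oplus a b) (at level 50, left associativity).
Local Notation "a ⊙ b" := (mv_odot a b) (at level 40, left associativity).
Local Notation "¬ a" := (mv_neg a) (at level 35, right associativity).
Local Notation "a ⊑ b" := (mv_le a b) (at level 70, no associativity).
Local Notation "⊥" := (mv_zero _).
Local Notation "⊤" := (mv_one _).

Section MVBasics.
Variable M : mvalg.
Implicit Types a b c d e x y z w t u v : M.

Lemma mv_oplusCA a b c : a ⊕ (b ⊕ c) = b ⊕ (a ⊕ c).
Proof. by rewrite -!mv_oplusA (mv_oplusC a). Qed.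

Lemma mv_oplusAC a b c : a ⊕ b ⊕ c = a ⊕ c ⊕ b.
Proof. by rewrite !mv_oplusA (mv_oplusC b). Qed.

Lemma mv_0oplus a : ⊥ ⊕ a = a.
Proof. by rewrite mv_oplusC mv_oplus0. Qed.

Lemma mv_neg1 : ¬ (⊤ : M) = ⊥.
Proof. by rewrite /mv_one mv_negK. Qed.

Lemma mv_oplus_one a : a ⊕ ⊤ = ⊤.
Proof. exact: mv_oplus1. Qed.

Lemma mv_oneoplus a : ⊤ ⊕ a = ⊤.
Proof. by rewrite mv_oplusC mv_oplus_one. Qed.

Lemma mv_negoplus a : ¬ a ⊕ a = ⊤.
Proof.
have := mv_luk a ⊤; rewrite mv_oplus_one mv_neg1 !mv_0oplus => <-.
by [].
Qed.

Lemma mv_oplusneg a : a ⊕ ¬ a = ⊤.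
Proof. by rewrite mv_oplusC mv_negoplus. Qed.

Lemma mv_neg_inj a b : ¬ a = ¬ b -> a = b.
Proof. by move=> h; rewrite -[a]mv_negK h mv_negK. Qed.

Lemma mv_leE a b : a ⊑ b <-> ¬ a ⊕ b = ⊤.
Proof.
rewrite /mv_le /mv_join; split => [h|->].
  by rewrite -{1}h mv_oplusCA -mv_oplusA mv_oplusA mv_negoplus.
by rewrite mv_neg1 mv_0oplus.
Qed.

Lemma mv_joinC a b : mv_join a b = mv_join b a.
Proof. exact: mv_luk. Qed.

Lemma mv_le_oplusr a b : a ⊑ a ⊕ b.
Proof. by apply/mv_leE; rewrite -mv_oplusA mv_negoplus mv_oneoplus. Qed.

Lemma mv_le_oplusl a b : a ⊑ b ⊕ a.
Proof. by rewrite mv_oplusC; exact: mv_le_oplusr. Qed.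

Lemma mv_leP a b : a ⊑ b <-> exists t, b = a ⊕ t.
Proof.
split=> [h|[t ->]]; last exact: mv_le_oplusr.
by exists (¬ (¬ b ⊕ a)); rewrite mv_oplusC -[RHS]mv_joinC.
Qed.

Lemma mv_le_refl a : a ⊑ a.
Proof. by apply/mv_leE; rewrite mv_negoplus. Qed.

Lemma mv_le_trans b a c : a ⊑ b -> b ⊑ c -> a ⊑ c.
Proof.
move=> /mv_leP[t ->] /mv_leP[u ->]; rewrite mv_oplusA; exact: mv_le_oplusr.
Qed.

Lemma mv_le_anti a b : a ⊑ b -> b ⊑ a -> a = b.
Proof. by rewrite /mv_le mv_joinC => -> ->. Qed.

Lemma mv_le_oplus2r c a b : a ⊑ b -> a ⊕ c ⊑ b ⊕ c.
Proof. move=> /mv_leP[t ->]; rewrite mv_oplusAC; exact: mv_le_oplusr. Qed.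

Lemma mv_le_oplus2 a b c d : a ⊑ b -> c ⊑ d -> a ⊕ c ⊑ b ⊕ d.
Proof.
move=> /(mv_le_oplus2r c) h /(mv_le_oplus2r b); rewrite ![_ ⊕ b]mv_oplusC.
exact: mv_le_trans.
Qed.

Lemma mv_le_neg a b : ¬ b ⊑ ¬ a <-> a ⊑ b.
Proof. by rewrite !mv_leE mv_negK mv_oplusC. Qed.

Lemma mv_0le a : ⊥ ⊑ a.
Proof. by apply/mv_leP; exists a; rewrite mv_0oplus. Qed.

Lemma mv_le1 a : a ⊑ ⊤.
Proof. by apply/mv_leE; rewrite mv_oplus_one. Qed.

Lemma mv_le0 a : a ⊑ ⊥ -> a = ⊥.
Proof. by move=> h; apply: mv_le_anti h (mv_0le a). Qed.

Lemma mv_1le a : ⊤ ⊑ a -> a = ⊤.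
Proof. by move=> h; apply: mv_le_anti (mv_le1 a) h. Qed.

Lemma mv_odotC a b : a ⊙ b = b ⊙ a.
Proof. by rewrite /mv_odot mv_oplusC. Qed.

Lemma mv_odotA a b c : a ⊙ b ⊙ c = a ⊙ (b ⊙ c).
Proof. by rewrite /mv_odot !mv_negK mv_oplusA. Qed.

Lemma mv_neg_odot a b : ¬ (a ⊙ b) = ¬ a ⊕ ¬ b.
Proof. by rewrite /mv_odot mv_negK. Qed.

Lemma mv_neg_oplus a b : ¬ (a ⊕ b) = ¬ a ⊙ ¬ b.
Proof. by rewrite /mv_odot !mv_negK. Qed.

Lemma mv_odotneg a : a ⊙ ¬ a = ⊥.
Proof. by rewrite /mv_odot mv_oplusneg mv_neg1. Qed.

Lemma mv_odot1 a : a ⊙ ⊤ = a.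
Proof. by rewrite /mv_odot mv_neg1 mv_oplus0 mv_negK. Qed.

Lemma mv_odot0 a : a ⊙ ⊥ = ⊥.
Proof. by rewrite /mv_odot [_ ⊕ _]mv_oplus_one mv_neg1. Qed.

Lemma mv_resid a b c : a ⊙ b ⊑ c <-> a ⊑ ¬ b ⊕ c.
Proof. by rewrite !mv_leE mv_neg_odot mv_oplusA. Qed.

Lemma mv_resid_neg a b c : a ⊙ ¬ b ⊑ c <-> a ⊑ b ⊕ c.
Proof. by rewrite mv_resid mv_negK. Qed.

Lemma mv_le_odot2r c a b : a ⊑ b -> a ⊙ c ⊑ b ⊙ c.
Proof. by rewrite /mv_odot mv_le_neg -mv_le_neg => h; apply: mv_le_oplus2r. Qed.

Lemma mv_odot_lel a b : a ⊙ b ⊑ a.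
Proof. by apply/mv_resid/mv_le_oplusl. Qed.

Lemma mv_odot_ler a b : a ⊙ b ⊑ b.
Proof. by rewrite mv_odotC; exact: mv_odot_lel. Qed.

Lemma mv_odot_eq0 a b : a ⊙ b = ⊥ <-> a ⊑ ¬ b.
Proof.
split=> [h|/(mv_le_odot2r b)]; last by rewrite [¬ b ⊙ _]mv_odotC mv_odotneg => /mv_le0.
by have /mv_resid : a ⊙ b ⊑ ⊥; [rewrite h; exact: mv_le_refl|rewrite mv_oplus0].
Qed.

Lemma mv_join_odot a b : mv_join a b = b ⊕ (a ⊙ ¬ b).
Proof. by rewrite /mv_join /mv_odot mv_negK mv_oplusC. Qed.

Lemma mv_meet_odot a b : mv_meet a b = a ⊙ (¬ a ⊕ b).
Proof.
by rewrite /mv_meet mv_joinC /mv_join /mv_odot !mv_negK mv_oplusC [b ⊕ _]mv_oplusC.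
Qed.

Lemma mv_meetC a b : mv_meet a b = mv_meet b a.
Proof. by rewrite /mv_meet mv_joinC. Qed.

Lemma mv_le_split a b : a ⊑ b -> b = a ⊕ (b ⊙ ¬ a).
Proof. by move=> h; rewrite -mv_join_odot mv_joinC. Qed.

Lemma mv_le_meetP a b : a ⊑ b <-> mv_meet a b = a.
Proof.
rewrite mv_meet_odot; split=> [/mv_leE ->|h]; first exact: mv_odot1.
rewrite -[X in X ⊑ _]h; apply/mv_resid.
by rewrite -/(mv_join a b) mv_joinC mv_join_odot; exact: mv_le_oplusr.
Qed.

(** The hypothesis says that the truncated sum does not overflow, so it can be undone by
    subtraction. *)
Lemma mv_oplusK a b : a ⊑ ¬ b -> (a ⊕ b) ⊙ ¬ b = a.
Proof.
move=> /mv_le_meetP; rewrite mv_meetC mv_meet_odot mv_negK mv_odotC.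
by rewrite [b ⊕ a]mv_oplusC.
Qed.

(** Neither sum overflows, so [c] is [(c ⊕ a) ⊙ ¬ a] and [b] is [(a ⊕ b) ⊙ ¬ a]; what remains is
    associativity of [⊙]. Together with [mv_carry_oplus] this gives the associativity of addition
    with carry. *)
Lemma mv_carry_odot a b c : c ⊙ a = ⊥ -> a ⊙ b = ⊥ ->
  (c ⊕ a) ⊙ b = c ⊙ (a ⊕ b).
Proof.
move=> /mv_odot_eq0 ca; rewrite mv_odotC => /mv_odot_eq0 ba.
rewrite -{2}(mv_oplusK ca) mv_odotA [¬ a ⊙ _]mv_odotC [a ⊕ b]mv_oplusC.
by rewrite (mv_oplusK ba).
Qed.

Lemma mv_carry_oplus a b c : c ⊕ a = ⊤ -> a ⊙ b = ⊥ ->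
  (c ⊙ a) ⊕ b = c ⊙ (a ⊕ b).
Proof.
move=> ca /mv_odot_eq0 ab.
have bv : b ⊑ c ⊙ (a ⊕ b).
  have nac : ¬ a ⊑ c by apply/mv_leE; rewrite mv_negK mv_oplusC.
  have := mv_le_odot2r (a ⊕ b) nac.
  suff -> : ¬ a ⊙ (a ⊕ b) = b by [].
  rewrite mv_odotC mv_oplusC mv_oplusK //.
  by rewrite -mv_le_neg mv_negK.
rewrite [RHS](mv_le_split bv) mv_odotA mv_oplusK //.
by rewrite mv_oplusC.
Qed.

Lemma mv_meet_le a b : mv_meet a b ⊑ a.
Proof. by rewrite mv_meet_odot; exact: mv_odot_lel. Qed.

Lemma mv_meet_ler a b : mv_meet a b ⊑ b.
Proof. by rewrite mv_meetC; exact: mv_meet_le. Qed.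

Lemma mv_le_joinl a b : a ⊑ mv_join a b.
Proof. by rewrite mv_joinC mv_join_odot; exact: mv_le_oplusr. Qed.

Lemma mv_le_joinr a b : b ⊑ mv_join a b.
Proof. by rewrite mv_joinC; exact: mv_le_joinl. Qed.

Lemma mv_join_le a b c : a ⊑ c -> b ⊑ c -> mv_join a b ⊑ c.
Proof.
move=> ac bc; have <- : mv_join c b = c by rewrite mv_joinC.
rewrite !mv_join_odot ![b ⊕ _]mv_oplusC.
exact/mv_le_oplus2r/mv_le_odot2r.
Qed.

Lemma mv_meet_glb a b c : c ⊑ a -> c ⊑ b -> c ⊑ mv_meet a b.
Proof.
move=> ca cb; rewrite -mv_le_neg /mv_meet mv_negK.
by apply: mv_join_le; rewrite mv_le_neg.
Qed.

Lemma mv_meet_oplus_le a b c :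
  mv_meet (a ⊕ b) c ⊑ mv_meet a c ⊕ mv_meet b c.
Proof.
set w := mv_meet _ _; have wab : w ⊑ a ⊕ b by exact: mv_meet_le.
have wc : w ⊑ c by exact: mv_meet_ler.
rewrite mv_oplusC; apply/mv_resid_neg/mv_meet_glb; last first.
  exact: mv_le_trans (mv_odot_lel _ _) wc.
apply/mv_resid_neg; rewrite mv_oplusC; apply/mv_resid_neg/mv_meet_glb.
  exact/mv_resid_neg.
exact: mv_le_trans (mv_odot_lel _ _) wc.
Qed.

(** In [0,1] one factor needs a + b > 1 and the other a + b < 1. In general, let [w] be the meet and
    [g = a ∧ ¬ b]. Both [a] and [¬ b] are [g] plus an element above [w], so [g ⊕ w] is below both
    and hence equals [g]; cancellation gives [w = ⊥]. *)
Lemma mv_odot_negoplus_disjoint a b : mv_meet (a ⊙ b) (¬ (a ⊕ b)) = ⊥.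
Proof.
set w := mv_meet _ _.
have wab : w ⊑ a ⊙ b by exact: mv_meet_le.
have wnab : w ⊑ ¬ (a ⊕ b) by exact: mv_meet_ler.
pose g := mv_meet a (¬ b).
have gw : w ⊑ ¬ g.
  apply: mv_le_trans wab _; apply: mv_le_trans (mv_odot_ler _ _) _.
  by rewrite -mv_le_neg mv_negK; exact: mv_meet_ler.
have ga : g ⊕ w ⊑ a.
  have -> : g = a ⊙ ¬ (a ⊙ b) by rewrite /g mv_meet_odot mv_neg_odot.
  rewrite [X in _ ⊑ X](mv_le_split (mv_odot_lel a b)) mv_oplusC.
  exact: mv_le_oplus2r.
have gb : g ⊕ w ⊑ ¬ b.
  have -> : g = ¬ b ⊙ ¬ (¬ a ⊙ ¬ b).
    by rewrite [¬ a ⊙ _]mv_odotC mv_neg_odot mv_negK /g mv_meetC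
      mv_meet_odot ?mv_negK.
  rewrite [X in _ ⊑ X](mv_le_split (mv_odot_ler (¬ a) (¬ b))) mv_oplusC.
  by apply: mv_le_oplus2r; rewrite -mv_neg_oplus.
have gwg : g ⊕ w = g.
  by apply: mv_le_anti (mv_meet_glb ga gb) (mv_le_oplusr _ _).
by have := mv_oplusK gw; rewrite mv_oplusC gwg mv_odotneg.
Qed.

Lemma mv_muln_add n k a : mv_muln (n + k)%N a = mv_muln n a ⊕ mv_muln k a.
Proof.
elim: n => [|n IH]; first by rewrite add0n mv_0oplus.
by rewrite addSn /= IH mv_oplusA.
Qed.

Lemma mv_meet_muln_le n a b : mv_meet (mv_muln n a) b ⊑ mv_muln n (mv_meet a b).
Proof.
elim: n => [|n IH] /=; first exact: mv_meet_le.
exact: mv_le_trans (mv_meet_oplus_le _ _ _) (mv_le_oplus2 (mv_le_refl _) IH).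
Qed.

Lemma mv_disjoint_muln n a b : mv_meet a b = ⊥ -> mv_meet (mv_muln n a) b = ⊥.
Proof.
move=> ab; apply: mv_le0; apply: mv_le_trans (mv_meet_muln_le n a b) _.
rewrite ab; elim: n => [|n IH] /=; first exact: mv_le_refl.
by rewrite mv_0oplus.
Qed.

End MVBasics.

(** * Hoelder's theorem for simple MV-algebras *)

Section MaximalIdeals.
Variable M : mvalg.
Implicit Types (a b d e x y : M) (I J m : set M).

Lemma mv_ideal_muln I n a : mv_ideal I -> I a -> I (mv_muln n a).
Proof. by move=> [I0 _ IU] Ia; elim: n => //= n IH; exact: IU. Qed.

Definition mv_adjoin I a : set M :=
  [set x | exists i n, I i /\ x ⊑ i ⊕ mv_muln n a].

Lemma mv_ideal_adjoin I a : mv_ideal I -> mv_ideal (mv_adjoin I a).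
Proof.
move=> [I0 IL IU]; split.
- by exists ⊥, 0%N; split=> //; exact: mv_0le.
- by move=> x y xy [i [n [Ii yi]]]; exists i, n; split=> //; exact: mv_le_trans yi.
- move=> x y [i [n [Ii xi]]] [j [k [Ij yj]]]; exists (i ⊕ j), (n + k)%N.
  split; first exact: IU.
  rewrite mv_muln_add -mv_oplusA (mv_oplusAC i j) mv_oplusA.
  exact: mv_le_oplus2.
Qed.

Lemma mv_sub_adjoin I a : I `<=` mv_adjoin I a.
Proof. by move=> i Ii; exists i, 0%N; split=> //; exact: mv_le_oplusr. Qed.

Lemma mv_in_adjoin I a : mv_ideal I -> mv_adjoin I a a.
Proof.
move=> [I0 _ _]; exists ⊥, 1%N; split=> //=.
by rewrite mv_0oplus mv_oplus0; exact: mv_le_refl.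
Qed.

Lemma mv_ideal_one I : mv_ideal I -> I ⊤ -> I = setT.
Proof. by move=> [_ IL _] I1; apply/seteqP; split=> // x _; exact: IL (mv_le1 x) I1. Qed.

Lemma mv_maximal_one m : mv_maximal m -> ~ m ⊤.
Proof. by move=> [mI mT _] /(mv_ideal_one mI). Qed.

Lemma mv_maximal_muln m a : mv_maximal m -> ~ m a -> exists n, m (¬ mv_muln n a).
Proof.
move=> [mI mT mM] nma.
have [h|h] := mM _ (mv_ideal_adjoin a mI) (@mv_sub_adjoin m a).
  by exfalso; apply: nma; rewrite -h; exact: mv_in_adjoin.
have : mv_adjoin m a ⊤ by rewrite h.
move=> [i [n [mi /mv_1le ni]]]; exists n; case: mI => _ IL _; apply: IL mi.
by apply/mv_leE; rewrite mv_negK mv_oplusC.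
Qed.

Lemma mv_exists_maximal I : mv_ideal I -> ~ I ⊤ ->
  exists m : MaxSpec M, I `<=` proj1_sig m.
Proof.
move=> II I1; have [I0 IL IU] := II.
(* Zorn's lemma is applied here to all chains, including the empty one, whose union is empty and not
   an ideal; adding [I] to every member repairs this. *)
pose P (A : set M) := mv_ideal (I `|` A) /\ ~ (I `|` A) ⊤.
have [F FP Ftot|A [[AI A1] Amax]] := @Zorn_bigcup M P.
  split; last by move=> [//|[A FA A1]]; have [_] := FP _ FA; apply; right.
  split; first by left.
  - move=> x y xy [Iy|[A FA Ay]]; first by left; exact: IL xy Iy.
    have [[_ AL _] _] := FP _ FA.
    by have [] := AL _ _ xy (or_intror Ay); [left|right; exists A].
  - suff aux A x y : F A -> (I `|` A) x -> (I `|` A) y ->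
        (I `|` \bigcup_(X in F) X) (x ⊕ y).
      move=> x y [Ix|[A FA Ax]] [Iy|[B FB By]].
      + by left; exact: IU.
      + by apply: (aux B) => //; [left|right].
      + by apply: (aux A) => //; [right|left].
      + have [AB|BA] := Ftot _ _ FA FB.
        * by apply: (aux B) => //; right=> //; exact: AB.
        * by apply: (aux A) => //; right=> //; exact: BA.
    move=> FA Ax Ay; have [[_ _ AU] _] := FP _ FA.
    by have [] := AU _ _ Ax Ay; [left|right; exists A].
suff mM : mv_maximal (I `|` A) by exists (exist _ _ mM) => x; left.
split=> [//|h|J JI AJ]; first by apply: A1; rewrite h.
have [J1|J1] := pselect (J ⊤); first by right; exact: mv_ideal_one.
left; apply/seteqP; split=> // x Jx; right; apply: contrapT => Ax.
have /Amax[] : A `<` J by split=> [y Ay|/(_ _ Jx)//]; apply: AJ; right.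
suff IJ : I `|` J = J by rewrite /P IJ.
by apply/setUidPr => y Iy; apply: AJ; left.
Qed.

End MaximalIdeals.

(** * The quotient by an ideal *)

Section Quotient.
Variables (M : mvalg) (m : set M) (mI : mv_ideal m).
Implicit Types a b c : M.

Definition mv_cong a b := m (a ⊙ ¬ b) /\ m (b ⊙ ¬ a).

Lemma mv_cong_refl a : mv_cong a a.
Proof. by case: mI => m0 _ _; split; rewrite mv_odotneg. Qed.

Lemma mv_cong_sym a b : mv_cong a b -> mv_cong b a.
Proof. by case. Qed.

Lemma mv_cong_trans b a c : mv_cong a b -> mv_cong b c -> mv_cong a c.
Proof.
case: mI => _ mL mU.
have aux x y z : m (x ⊙ ¬ y) -> m (y ⊙ ¬ z) -> m (x ⊙ ¬ z).
  move=> xy yz; apply: mL (mU _ _ xy yz); apply/mv_resid_neg.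
  rewrite mv_oplusCA -mv_join_odot mv_oplusC.
  apply: mv_le_trans (mv_le_oplus2r _ (mv_le_joinl y z)).
  by rewrite -mv_join_odot; exact: mv_le_joinl.
by move=> [ab ba] [bc cb]; split; [exact: aux ab bc|exact: aux cb ba].
Qed.

Lemma mv_cong_neg a b : mv_cong a b -> mv_cong (¬ a) (¬ b).
Proof. by move=> [ab ba]; split; rewrite mv_negK mv_odotC. Qed.

Lemma mv_cong_oplus c a b : mv_cong a b -> mv_cong (a ⊕ c) (b ⊕ c).
Proof.
case: mI => _ mL _.
have aux x y : m (x ⊙ ¬ y) -> m ((x ⊕ c) ⊙ ¬ (y ⊕ c)).
  apply: mL; apply/mv_resid_neg; rewrite mv_oplusAC; apply: mv_le_oplus2r.
  by rewrite -mv_join_odot; exact: mv_le_joinl.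
by move=> [ab ba]; split; exact: aux.
Qed.

Definition mv_class a : set M := [set b | mv_cong a b].
Definition mv_quot_car : Type := {A : set M | exists a, A = mv_class a}.
Definition mv_proj a : mv_quot_car := exist _ (mv_class a) (ex_intro _ a erefl).
Definition mv_repr (A : mv_quot_car) : M := projT1 (cid (proj2_sig A)).

Lemma mv_projP a b : mv_proj a = mv_proj b <-> mv_cong a b.
Proof.
split=> [[h]|ab].
  have : mv_class b b by exact: mv_cong_refl.
  by rewrite -h.
apply/eq_exist/seteqP; split=> x.
  exact/mv_cong_trans/mv_cong_sym.
exact: mv_cong_trans.
Qed.

Lemma mv_reprK A : mv_proj (mv_repr A) = A.
Proof.
case: A => A hA; apply/eq_exist; rewrite /mv_repr; case: cid => a /= ->.
by [].
Qed.

Definition mv_quot_oplus A B := mv_proj (mv_repr A ⊕ mv_repr B).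
Definition mv_quot_neg A := mv_proj (¬ mv_repr A).

Lemma mv_quot_oplusE a b :
  mv_quot_oplus (mv_proj a) (mv_proj b) = mv_proj (a ⊕ b).
Proof.
apply/mv_projP; apply: (@mv_cong_trans (a ⊕ mv_repr (mv_proj b))).
  by apply: mv_cong_oplus; apply/mv_projP; rewrite mv_reprK.
rewrite ![a ⊕ _]mv_oplusC.
by apply: mv_cong_oplus; apply/mv_projP; rewrite mv_reprK.
Qed.

Lemma mv_quot_negE a : mv_quot_neg (mv_proj a) = mv_proj (¬ a).
Proof. by apply/mv_projP/mv_cong_neg/mv_projP; rewrite mv_reprK. Qed.

Definition mv_quot : mvalg.
Proof.
apply: (@MVAlg mv_quot_car mv_quot_oplus mv_quot_neg (mv_proj ⊥)).
- move=> A B C; rewrite -(mv_reprK A) -(mv_reprK B) -(mv_reprK C).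
  by rewrite !mv_quot_oplusE mv_oplusA.
- by move=> A B; rewrite /mv_quot_oplus mv_oplusC.
- by move=> A; rewrite -(mv_reprK A) mv_quot_oplusE mv_oplus0.
- by move=> A; rewrite -(mv_reprK A) !mv_quot_negE mv_negK.
- by move=> A; rewrite -(mv_reprK A) !mv_quot_negE mv_quot_oplusE mv_oplus1.
- move=> A B; rewrite -(mv_reprK A) -(mv_reprK B).
  by rewrite !(mv_quot_negE, mv_quot_oplusE) mv_luk.
Defined.

Lemma mv_proj_eq0 a : (mv_proj a : mv_quot) = ⊥ <-> m a.
Proof.
case: mI => m0 mL _.
rewrite mv_projP /mv_cong [⊥ ⊙ _]mv_odotC mv_odot0 [¬ ⊥]/(⊤) mv_odot1.
by split=> [[]|].
Qed.

Lemma mv_proj_muln n a : mv_muln n (mv_proj a : mv_quot) = mv_proj (mv_muln n a).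
Proof. by elim: n => //= n ->; exact: mv_quot_oplusE. Qed.

End Quotient.

(** * Homogenisation of functions that are additive up to a carry *)

Section QuasiAdditive.
Variables (R : realType) (T : Type) (add : T -> T -> T) (Q : T -> nat).
Hypothesis addA : forall x y z, add (add x y) z = add x (add y z).
Hypothesis addC : forall x y, add x y = add y x.
Hypothesis QD : forall x y, (Q x + Q y <= Q (add x y) <= (Q x + Q y).+1)%N.

(** [T] has no zero, so this is the sum of n+1 copies of [x]; hence the shifts by one below. *)
Let mult n x := iter n (add x) x.

Let mult_mult m n x : mult m (mult n x) = mult (m * n + m + n)%N x.
Proof.
have multD k l y : add (mult k y) (mult l y) = mult (k + l).+1 y.
  by elim: k => //= k IH; rewrite addA IH.
elim: m => [|m IH]; first by rewrite add0n.
rewrite [LHS]/= IH multD; congr mult; lia.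
Qed.

Let Q_mult m x : (m.+1 * Q x <= Q (mult m x) <= m.+1 * Q x + m)%N.
Proof.
elim: m => [|m IH]; first by rewrite /= mul1n addn0 leqnn.
have := QD x (mult m x); rewrite /= -/(mult m x); lia.
Qed.

(** Both sides are compared with [Q] of the (m+1)(n+1)-fold sum. Thus every lower quotient Q(mult n
    x)/(n+1) is below every upper quotient (Q(mult m x)+1)/(m+1), and their supremum lies
    between. *)
Let Q_cross m n x : (m.+1 * Q (mult n x) <= n.+1 * (Q (mult m x)).+1)%N.
Proof.
have /andP[h _] := Q_mult m (mult n x); have /andP[_ k] := Q_mult n (mult m x).
move: h k; rewrite !mult_mult (_ : (m * n + m + n)%N = (n * m + n + m)%N); lia.
Qed.

Lemma archimedean_eq0 (z c : R) : (forall n, n.+1%:R * `|z| <= c) -> z = 0.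
Proof.
move=> h; apply/eqP; rewrite -normr_le0 leNgt; apply/negP => z0.
have c0 : 0 <= c by apply: le_trans (h 0%N); rewrite mul1r.
have /archi_boundP : 0 <= c / `|z| by rewrite divr_ge0.
set k := Num.bound _; rewrite ltr_pdivrMr // => ck.
have := h k; rewrite -natr1 mulrDl mul1r; lra.
Qed.

Lemma quasi_additive_hom : exists h : T -> R,
  (forall x y, h (add x y) = h x + h y) /\
  (forall n x, (Q (iter n (add x) x))%:R <= n.+1%:R * h x
                 <= (Q (iter n (add x) x)).+1%:R).
Proof.
pose S x : set R := [set (Q (mult n x))%:R / n.+1%:R | n in setT].
pose h x := sup (S x).
have hb n x : (Q (mult n x))%:R <= n.+1%:R * h x <= (Q (mult n x)).+1%:R.
  have Sb k : ubound (S x) ((Q (mult k x)).+1%:R / k.+1%:R).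
    move=> _ [l _ <-]; rewrite ler_pdivrMr ?ltr0n // mulrAC ler_pdivlMr ?ltr0n //.
    by rewrite -!natrM ler_nat mulnC [leqRHS]mulnC Q_cross.
  apply/andP; split.
    rewrite mulrC -ler_pdivrMr ?ltr0n //; apply: ub_le_sup; last by exists n.
    by exists ((Q (mult 0 x)).+1%:R / 1%:R).
  rewrite mulrC -ler_pdivlMr ?ltr0n //; apply: ge_sup; last exact: Sb.
  by exists ((Q (mult 0 x))%:R / 1%:R), 0%N.
exists h; split=> // x y; apply/eqP; rewrite -subr_eq0; apply/eqP.
apply: (@archimedean_eq0 _ 3) => n.
have multD : mult n (add x y) = add (mult n x) (mult n y).
  elim: n => //= n; rewrite -!/(mult _ _) => ->.
  by rewrite !addA; congr add; rewrite -!addA (addC y).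
have := hb n (add x y); have := hb n x; have := hb n y; rewrite multD.
have /andP[] := QD (mult n x) (mult n y).
rewrite -(ler_nat R) -(ler_nat R _ _.+1) -!natr1 !natrD => q1 q2.
rewrite -[X in X * `|_|]ger0_norm ?ler0n // -normrM mulrBr mulrDr ler_norml.
by move=> /andP[? ?] /andP[? ?] /andP[? ?]; apply/andP; split; lra.
Qed.

End QuasiAdditive.

(* A simple MV-algebra is a chain; [Z * C] with addition with carry is Chang's
   totally ordered group, of which the nonnegative part suffices here. *)
Section Hoelder.
Variables (R : realType) (C : mvalg).
Hypothesis C_nontrivial : (⊤ : C) <> ⊥.
Hypothesis C_simple : forall a : C, a <> ⊥ -> exists n, mv_muln n a = ⊤.
Implicit Types a b c : C.

(** By simplicity a multiple of [¬ (a ⊕ b)] is [⊤], while every multiple of it is disjoint from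
    [a ⊙ b]. This dichotomy replaces the total order of [C]. *)
Lemma simple_odot_eq0 a b : a ⊕ b <> ⊤ -> a ⊙ b = ⊥.
Proof.
move=> ab; have [n n1] : exists n, mv_muln n (¬ (a ⊕ b)) = ⊤.
  by apply: C_simple => h; apply: ab; rewrite -[_ ⊕ _]mv_negK h.
have := mv_odot_negoplus_disjoint a b; rewrite mv_meetC.
move=> /(mv_disjoint_muln n); rewrite n1 mv_meetC => <-.
by rewrite mv_meet_odot mv_oplus_one mv_odot1.
Qed.

(** The pair (n, a) stands for n + a. The pairs (n, [⊤]) and (n+1, [⊥]) are not identified: addition
    is associative on raw pairs, and the additive real function obtained below agrees on them. *)
Definition carry_add (x y : nat * C) : nat * C :=
  if `[< x.2 ⊕ y.2 = ⊤ >] then ((x.1 + y.1).+1, x.2 ⊙ y.2)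
  else ((x.1 + y.1)%N, x.2 ⊕ y.2).

Lemma carry_addC x y : carry_add x y = carry_add y x.
Proof. by rewrite /carry_add mv_oplusC mv_odotC addnC. Qed.

Lemma carry_addA x y z :
  carry_add (carry_add x y) z = carry_add x (carry_add y z).
Proof.
case: x y z => [n c] [p a] [q b]; rewrite /carry_add /=.
have le1 u v : u ⊑ v -> v <> ⊤ -> u <> ⊤ by move=> uv + h; rewrite h in uv; move/mv_1le : uv.
case: (asboolP (a ⊕ b = ⊤)) => ab; case: (asboolP (c ⊕ a = ⊤)) => ca /=.
- have e : c ⊙ a ⊕ b = c ⊕ (a ⊙ b).
    apply: mv_neg_inj; rewrite !mv_neg_oplus !mv_neg_odot.
    by apply: mv_carry_odot; rewrite -mv_neg_oplus ?ca ?ab mv_neg1.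
  rewrite e mv_odotA; case: asboolP => _; congr (_, _); lia.
- have e : (c ⊕ a) ⊙ b = c ⊕ (a ⊙ b).
    rewrite [RHS]mv_oplusC [a ⊙ b]mv_odotC (mv_carry_oplus (c := b)).
    + by rewrite [LHS]mv_odotC mv_oplusC [a ⊕ c]mv_oplusC mv_oplusC.
    + by rewrite mv_oplusC.
    + by rewrite mv_odotC; exact: simple_odot_eq0.
  rewrite mv_oplusA ab mv_oplus_one asboolT // -e asboolF; first by congr (_, _); lia.
  exact: le1 (mv_odot_lel _ _) ca.
- rewrite (mv_carry_oplus ca (simple_odot_eq0 ab)) asboolF; last first.
    by apply: le1 ab; exact: mv_odot_ler.
  rewrite -mv_oplusA ca mv_oneoplus asboolT //; congr (_, _); lia.
- rewrite mv_oplusA (mv_carry_odot (simple_odot_eq0 ca) (simple_odot_eq0 ab)).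
  case: asboolP => _; congr (_, _); lia.
Qed.

(** The integer part is additive up to a carry, so it homogenises to an additive [h]; a carry is
    worth [H ⊤ = 1], which turns additivity on pairs into truncated addition on [C]. The kernel is
    trivial because a multiple of any nonzero element is [⊤]. *)
Lemma simple_hom01 : exists2 h : C -> R, mvhom01 h & forall x, h x = 0 -> x = ⊥.
Proof.
have QD x y : (x.1 + y.1 <= (carry_add x y).1 <= (x.1 + y.1).+1)%N.
  by rewrite /carry_add; case: asboolP => _ /=; lia.
have [h [hD hQ]] := quasi_additive_hom R carry_addA carry_addC QD.
pose H a := h (0%N, a).
have H0 : H ⊥ = 0.
  have := hD (0%N, ⊥) (0%N, ⊥); rewrite /carry_add /= mv_oplus0 asboolF /=.
    rewrite -/(H ⊥); lra.
  by move=> e; apply: C_nontrivial.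
have H1 : H ⊤ = 1.
  apply/eqP; rewrite -subr_eq0; apply/eqP; apply: (@archimedean_eq0 R _ 1) => n.
  have := hQ n (0%N, ⊤).
  have -> : iter n (carry_add (0%N, ⊤)) (0%N, ⊤) = (n, ⊤).
    elim: n => //= n ->; rewrite /carry_add /= mv_oplus_one asboolT //.
    by rewrite mv_odot1.
  rewrite -/(H _) /= -[X in X * `|_|]ger0_norm ?ler0n // -normrM mulrBr mulr1.
  rewrite -natr1 ler_norml => /andP[? ?]; apply/andP; split; lra.
have Hge a : 0 <= H a.
  by have /andP[+ _] := hQ 0%N (0%N, a); rewrite mul1r.
have HD a b : a ⊕ b <> ⊤ -> H (a ⊕ b) = H a + H b.
  by move=> ab; rewrite -hD /carry_add /= asboolF.
have HD1 a b : a ⊕ b = ⊤ -> H a + H b = 1 + H (a ⊙ b).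
  move=> ab; rewrite -H1 -!hD /carry_add /= mv_oneoplus asboolT // asboolT //.
  by rewrite [⊤ ⊙ _]mv_odotC mv_odot1.
have HN a : H (¬ a) = 1 - H a.
  by have := HD1 _ _ (mv_oplusneg a); rewrite mv_odotneg H0; lra.
have Hle a : H a <= 1 by have := HN a; have := Hge (¬ a); lra.
have Hadd a b : H (a ⊕ b) = Num.min 1 (H a + H b).
  have [ab|ab] := pselect (a ⊕ b = ⊤).
    by rewrite ab H1; have := Hge (a ⊙ b); have := HD1 _ _ ab; rewrite /Order.min; case: ltP; lra.
  by rewrite -HD //; have := Hle (a ⊕ b); rewrite /Order.min; case: ltP; lra.
exists H; first by split=> // x; rewrite Hge Hle.
move=> x Hx; apply: contrapT => /C_simple[n n1].
suff : H (mv_muln n x) = 0 by rewrite n1 H1; lra.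
by elim: {n1} n => //= n IH; rewrite Hadd Hx IH addr0 /Order.min; case: ltP; lra.
Qed.

End Hoelder.

Lemma maximal_hom01 (R : realType) (M : mvalg) (m : set M) : mv_maximal m ->
  exists2 h : M -> R, mvhom01 h & forall x, h x = 0 <-> m x.
Proof.
move=> mM; have [mI _ _] := mM.
have [||h [h01 hD hN h0] hinj] := @simple_hom01 R (mv_quot mI).
- move=> e; apply: (mv_maximal_one mM); apply/(mv_proj_eq0 mI).
  by rewrite -e /mv_one /= mv_quot_negE.
- move=> A; rewrite -(mv_reprK A) => A0.
  have /(mv_maximal_muln mM)[n /(mv_proj_eq0 mI)] : ~ m (mv_repr A).
    by move/(mv_proj_eq0 mI).
  rewrite -(mv_quot_negE mI) => e; exists n; rewrite mv_proj_muln.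
  by apply: mv_neg_inj; rewrite mv_neg1.
exists (fun a => h (mv_proj m a)).
  split=> //; first by move=> x y; rewrite -hD /= mv_quot_oplusE.
  by move=> x; rewrite -hN /= mv_quot_negE.
move=> x; rewrite -(mv_proj_eq0 mI); split; first exact: hinj.
by move=> ->.
Qed.

(** * Evaluation at maximal ideals *)

Ltac minmax_cases :=
  rewrite /Order.min /Order.max;
  repeat match goal with
  | |- context [if ?a < ?b then _ else _] =>
    lazymatch constr:((a, b)) with
    | context [if _ then _ else _] => fail
    | _ => case: (ltP a b) => ?
    end
  end; intros.
Ltac minmax_lra := minmax_cases; lra.

Section Hom01.
Variables (R : realType) (M : mvalg) (h : M -> R) (hh : mvhom01 h).
Implicit Types a b x y : M.

Lemma hom01_ge0 a : 0 <= h a.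
Proof. by case: hh => /(_ a)/andP[]. Qed.

Lemma hom01_le1 a : h a <= 1.
Proof. by case: hh => /(_ a)/andP[]. Qed.

Lemma hom01D a b : h (a ⊕ b) = Num.min 1 (h a + h b).
Proof. by case: hh. Qed.

Lemma hom01N a : h (¬ a) = 1 - h a.
Proof. by case: hh. Qed.

Lemma hom01_0 : h ⊥ = 0.
Proof. by case: hh. Qed.

Lemma hom01_1 : h ⊤ = 1.
Proof. by rewrite hom01N hom01_0 subr0. Qed.

Lemma hom01M a b : h (a ⊙ b) = Num.max 0 (h a + h b - 1).
Proof. by rewrite /mv_odot hom01N hom01D !hom01N; minmax_lra. Qed.

Lemma hom01_join a b : h (mv_join a b) = Num.max (h a) (h b).
Proof.
rewrite mv_join_odot hom01D hom01M hom01N.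
have := hom01_le1 a; have := hom01_le1 b; minmax_lra.
Qed.

Lemma hom01_meet a b : h (mv_meet a b) = Num.min (h a) (h b).
Proof. by rewrite /mv_meet hom01N hom01_join !hom01N; minmax_lra. Qed.

Lemma hom01_le a b : a ⊑ b -> h a <= h b.
Proof. by rewrite /mv_le => <-; rewrite hom01_join; minmax_lra. Qed.

Lemma hom01_muln_gt0 n a : 0 < h a -> 1 <= n%:R * h a -> h (mv_muln n a) = 1.
Proof.
move=> a0; have : h (mv_muln n a) = Num.min 1 (n%:R * h a).
  elim: n => [|n IH] /=; first by rewrite hom01_0 mul0r; minmax_lra.
  by rewrite hom01D IH -natr1 mulrDl mul1r; minmax_lra.
by move=> -> ?; minmax_lra.
Qed.

End Hom01.

(** A dyadic threshold on [h a] becomes nonvanishing of a term [t] chosen independently of [h]: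
    [a ⊕ a] doubles the lower half of [0,1] and [a ⊙ a] the upper half, each using up one binary
    digit. Thus the kernel determines [h], and superlevel sets of [mvstar R a] are open. *)
Lemma hom01_dyadic (R : realType) (M : mvalg) (k j : nat) (a : M) :
  exists t : M, forall h : M -> R, mvhom01 h -> (j%:R / 2 ^+ k < h a <-> 0 < h t).
Proof.
elim: k j a => [|k IH] j a.
  case: j => [|j].
    by exists a => h hh; rewrite mul0r.
  exists ⊥ => h hh; rewrite expr0 divr1 (hom01_0 hh) ltxx; split=> //.
  by have := hom01_le1 hh a; rewrite -natr1; have := ler0n R j; lra.
have e2 : (0 : R) < 2 ^+ k by rewrite exprn_gt0.
have half (n : nat) : n%:R / 2 ^+ k.+1 = (n%:R / 2 ^+ k) / 2 :> R.
  by rewrite exprS invfM mulrA mulrAC.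
have [jk|kj] := ltnP j (2 ^ k).
  have [t ht] := IH j (a ⊕ a); exists t => h hh.
  rewrite half -ht // (hom01D hh).
  have j1 : j%:R / 2 ^+ k < 1 :> R by rewrite ltr_pdivrMr // mul1r -natrX ltr_nat.
  by split; minmax_lra.
have [t ht] := IH (j - 2 ^ k)%N (a ⊙ a); exists t => h hh.
rewrite half -ht // (hom01M hh) natrB // natrX mulrBl divff ?gt_eqF //.
have j1 : 1 <= j%:R / 2 ^+ k :> R by rewrite ler_pdivlMr // mul1r -natrX ler_nat.
by split; minmax_lra.
Qed.

Lemma dyadic_dense (R : realType) (x y : R) : 0 <= x -> x < y ->
  exists j k : nat, x <= j%:R / 2 ^+ k < y.
Proof.
move=> x0 xy; have yx : 0 < y - x by rewrite subr_gt0.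
pose k := Num.bound (y - x)^-1.
have hk : (y - x)^-1 < 2 ^+ k.
  apply: lt_trans (archi_boundP _) _; first by rewrite invr_ge0 ltW.
  by rewrite -natrX ltr_nat ltn_expl.
have k0 : (0 : R) < 2 ^+ k by rewrite exprn_gt0.
have x20 : 0 <= x * 2 ^+ k by rewrite mulr_ge0 // ltW.
have /andP[t1 t2] := truncn_itv x20.
exists (Num.truncn (x * 2 ^+ k)).+1, k; rewrite ler_pdivlMr // ltr_pdivrMr //.
rewrite (ltW t2) /= -natr1.
have : 1 < (y - x) * 2 ^+ k by rewrite mulrC -ltr_pdivrMr // div1r.
rewrite mulrBl; lra.
Qed.

Lemma hom01_unique (R : realType) (M : mvalg) (g h : M -> R) :
  mvhom01 g -> mvhom01 h -> (forall x, g x = 0 <-> h x = 0) -> g =1 h.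
Proof.
move=> gg hh gh a.
suff le (f1 f2 : M -> R) : mvhom01 f1 -> mvhom01 f2 ->
    (forall x, f1 x = 0 <-> f2 x = 0) -> f1 a <= f2 a.
  by apply/eqP; rewrite eq_le !le // => x; rewrite gh.
move=> f1h f2h f12; rewrite leNgt; apply/negP => fa.
have [j [k /andP[j1 j2]]] := dyadic_dense (hom01_ge0 f2h a) fa.
have [t ht] := hom01_dyadic R k j a.
have t1 : 0 < f1 t by apply/ht.
have : 0 < f2 t.
  rewrite lt_neqAle hom01_ge0 // andbT eq_sym; apply/eqP => /f12 e.
  by rewrite e ltxx in t1.
by move/ht => /(_ f2h); rewrite ltNge j1.
Qed.

(** * The spectral topology and continuity of evaluations *)

Section Star.
Variables (R : realType) (M : mvalg).
Implicit Types (a b x : M) (m : MaxSpec M).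
Local Notation st := (@mvstar R M).

(** Existence is Hoelder's theorem and uniqueness is [hom01_unique], so the default of [xget] in
    [mvstar] is never taken. *)
Lemma mvstar_spec m : mvhom01 (st^~ m) /\ forall x, st x m = 0 <-> proj1_sig m x.
Proof.
have [h hh hm] := maximal_hom01 R (proj2_sig m).
suff e a : st a m = h a.
  split=> [|x]; last by rewrite e.
  by have -> : st^~ m = h by exact/funext.
rewrite /mvstar; apply: xget_unique; first by exists h.
move=> _ [g [gg gm <-]]; apply: hom01_unique => // x.
by rewrite gm hm.
Qed.

Lemma mvstar_hom m : mvhom01 (st^~ m).
Proof. by have [] := mvstar_spec m. Qed.

Definition star_ge0 a m : 0 <= st a m := hom01_ge0 (mvstar_hom m) a.
Definition star_le1 a m : st a m <= 1 := hom01_le1 (mvstar_hom m) a.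
Definition starD a b m : st (a ⊕ b) m = Num.min 1 (st a m + st b m) :=
  hom01D (mvstar_hom m) a b.
Definition starN a m : st (¬ a) m = 1 - st a m := hom01N (mvstar_hom m) a.
Definition star0 m : st ⊥ m = 0 := hom01_0 (mvstar_hom m).
Definition star1 m : st ⊤ m = 1 := hom01_1 (mvstar_hom m).
Definition starM a b m : st (a ⊙ b) m = Num.max 0 (st a m + st b m - 1) :=
  hom01M (mvstar_hom m) a b.
Definition star_join a b m : st (mv_join a b) m = Num.max (st a m) (st b m) :=
  hom01_join (mvstar_hom m) a b.
Definition star_meet a b m : st (mv_meet a b) m = Num.min (st a m) (st b m) :=
  hom01_meet (mvstar_hom m) a b.
Definition star_le a b m : a ⊑ b -> st a m <= st b m := @hom01_le _ _ _ (mvstar_hom m) a b.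

Lemma star_eq0 a m : st a m = 0 <-> proj1_sig m a.
Proof. by have [] := mvstar_spec m. Qed.

Lemma star_gt0 a m : ~ proj1_sig m a <-> 0 < st a m.
Proof.
rewrite -star_eq0 lt_neqAle star_ge0 andbT eq_sym; split; first by move/eqP.
by move/eqP.
Qed.

Lemma max_openP (U : set (MaxSpec M)) : max_open U <->
  forall m, U m -> exists a, 0 < st a m /\ forall m', 0 < st a m' -> U m'.
Proof.
split=> [[S ->] m [s Ss ms]|H].
  by exists s; split; [exact/star_gt0|move=> m' /star_gt0; exists s].
exists [set a | forall m', 0 < st a m' -> U m']; apply/seteqP; split=> m.
  by move=> /H[a [am aU]]; exists a => //; exact/star_gt0.
by move=> [a aU /star_gt0]; exact: aU.
Qed.

Lemma max_openU_local (U : set (MaxSpec M)) :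
  (forall m, U m -> exists V, [/\ max_open V, V m & V `<=` U]) -> max_open U.
Proof.
move=> H; apply/max_openP => m /H[V [/max_openP Vo Vm VU]].
by have [a [am aV]] := Vo _ Vm; exists a; split=> // m' /aV/VU.
Qed.

Lemma max_openI (U V : set (MaxSpec M)) : max_open U -> max_open V -> max_open (U `&` V).
Proof.
move=> /max_openP Uo /max_openP Vo; apply/max_openP => m [/Uo[a [am aU]] /Vo[b [bm bV]]].
exists (mv_meet a b); rewrite star_meet lt_min am bm; split=> // m'.
by rewrite star_meet lt_min => /andP[/aU ? /bV].
Qed.

Lemma max_open_bigcup (I : Type) (F : I -> set (MaxSpec M)) :
  (forall i, max_open (F i)) -> max_open (\bigcup_i F i).
Proof.
move=> Fo; apply: max_openU_local => m [i _ Fm]; exists (F i); split=> //.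
exact: bigcup_sup.
Qed.

Lemma max_openU (U V : set (MaxSpec M)) : max_open U -> max_open V -> max_open (U `|` V).
Proof.
move=> Uo Vo; apply: max_openU_local => m [h|h]; [exists U|exists V]; split=> //.
Qed.

Lemma max_open0 : max_open (set0 : set (MaxSpec M)).
Proof. by apply/max_openP. Qed.

Lemma max_openT : max_open (setT : set (MaxSpec M)).
Proof. by apply/max_openP => m _; exists ⊤; rewrite star1. Qed.

Lemma max_open_gt a (r : R) : max_open [set m | r < st a m].
Proof.
apply/max_openP => m /= rm.
have [r0|r0] := ltP r 0.
  by exists ⊤; rewrite star1; split=> // m' _; apply: lt_le_trans (star_ge0 _ _).
have [j [k /andP[j1 j2]]] := dyadic_dense r0 rm.
have [t ht] := hom01_dyadic R k j a; exists t; split; first exact/(ht _ (mvstar_hom m)).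
by move=> m' /(ht _ (mvstar_hom m')); exact: le_lt_trans.
Qed.

Lemma max_open_lt a (r : R) : max_open [set m | st a m < r].
Proof.
rewrite (_ : [set _ | _] = [set m | 1 - r < st (¬ a) m]); first exact: max_open_gt.
by apply/funext => m /=; rewrite starN ltrD2l ltrN2.
Qed.

Lemma max_continuousP (f : MaxSpec M -> R) : max_continuous f <->
  forall m (e : R), 0 < e ->
    exists V, [/\ max_open V, V m & forall m', V m' -> `|f m' - f m| < e].
Proof.
split=> [fc m e e0|H V Vo].
  exists (f @^-1` ball (f m) e); split.
  - by apply: fc; exact: ball_open.
  - exact: ballxx.
  - by move=> m'; rewrite /= /ball /= distrC.
apply: max_openU_local => m Vm.
have /nbhs_ballP[e /= e0 eV] : nbhs (f m) V by exact: open_nbhs_nbhs.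
have [W [Wo Wm Wf]] := H m e e0; exists W; split=> // m' /Wf h.
by apply: eV; rewrite /ball /= distrC.
Qed.

Lemma star_continuous a : max_continuous (st a).
Proof.
apply/max_continuousP => m e e0.
exists ([set m' | st a m - e < st a m'] `&` [set m' | st a m' < st a m + e]); split.
- by apply: max_openI; [exact: max_open_gt|exact: max_open_lt].
- by split=> /=; lra.
- by move=> m' [/= ? ?]; rewrite ltr_norml; apply/andP; split; lra.
Qed.

Lemma max_continuousD (f g : MaxSpec M -> R) :
  max_continuous f -> max_continuous g -> max_continuous (f \+ g).
Proof.
move=> /max_continuousP fc /max_continuousP gc; apply/max_continuousP => m e e0.
have e2 : 0 < e / 2 by lra.
have [V [Vo Vm Vf]] := fc m _ e2; have [W [Wo Wm Wg]] := gc m _ e2.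
exists (V `&` W); split=> //; first exact: max_openI.
move=> m' [/Vf + /Wg]; rewrite !ltr_norml /= => /andP[? ?] /andP[? ?].
by apply/andP; split; lra.
Qed.

Lemma max_continuousZ (c : R) (f : MaxSpec M -> R) :
  max_continuous f -> max_continuous (fun m => c * f m).
Proof.
move=> /max_continuousP fc; apply/max_continuousP => m e e0.
have c0 : 0 < `|c| + 1 by have := normr_ge0 c; lra.
have [|V [Vo Vm Vf]] := fc m (e / (`|c| + 1)); first by rewrite divr_gt0.
exists V; split=> // m' /Vf; rewrite ltr_pdivlMr // -mulrBr normrM.
by have := normr_ge0 (f m' - f m); nra.
Qed.

Lemma max_continuous0 : max_continuous (fun _ : MaxSpec M => 0 : R).
Proof.
apply/max_continuousP => m e e0; exists setT; split=> //; first exact: max_openT.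
by rewrite subrr normr0.
Qed.

End Star.

Lemma max_spec_compact (M : mvalg) : max_compact (setT : set (MaxSpec M)).
Proof.
move=> I O /choice[S OS] cov.
(* [J] is the union, over finite [D], of the ideals generated by the [S i] with [i] in [D]. If it
   contains [⊤], such a [D] is a subcover; otherwise a maximal ideal above [J] escapes the cover. *)
pose J : set M := [set x | exists2 D : set I, finite_set D &
  forall m, mv_ideal m -> (forall i, D i -> S i `<=` m) -> m x].
have JI : mv_ideal J.
  split.
  - by exists set0 => // m [].
  - move=> x y xy [D Df Dy]; exists D => // m mI Dm.
    by have [_ mL _] := mI; apply: mL xy _; exact: Dy.
  - move=> x y [D Df Dx] [E Ef Ey]; exists (D `|` E); first by rewrite finite_setU.
    move=> m mI Dm; have [_ _ mU] := mI; apply: mU.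
      by apply: Dx => // i Di; apply: Dm; left.
    by apply: Ey => // i Ei; apply: Dm; right.
have [[D Df D1]|J1] := pselect (J ⊤).
  exists D => // m _; apply: contrapT => h.
  apply: (mv_maximal_one (proj2_sig m)); apply: D1; first by case: (proj2_sig m).
  move=> i Di s Ss; apply: contrapT => ms; apply: h; exists i => //.
  by rewrite OS; exists s.
have [m Jm] := mv_exists_maximal JI J1.
have [i _] := cov m Logic.I; rewrite OS => -[s Ss []]; apply: Jm.
by exists [set i] => // m' _; apply.
Qed.

(** * Complete MV-algebras *)

Lemma finite_set_induct (T : Type) (P : set T -> Prop) : P set0 ->
  (forall A x, P A -> P (x |` A)) -> forall A, finite_set A -> P A.
Proof.
move=> P0 PU A /finite_setP[n]; elim: n A => [|n IH] A.
  by rewrite II0 card_eq0 => /eqP ->.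
move=> /eq_cardSP[x Ax /IH PA]; rewrite -(setD1K Ax); exact: PU.
Qed.

Definition mv_boolean (M : mvalg) (b : M) : Prop := b ⊕ b = b.

(** * Boolean elements and clopen sets *)

Section BooleanStar.
Variables (R : realType) (M : mvalg).
Implicit Types (a b c : M) (m : MaxSpec M).
Local Notation st := (@mvstar R M).

Lemma boolean_star b m : mv_boolean b -> st b m = 0 \/ st b m = 1.
Proof.
move=> bb; have := starD R b b m; rewrite bb; have := star_ge0 R b m.
rewrite /Order.min; case: ltP => ? ? ?; [right|left]; lra.
Qed.

Lemma boolean0 : mv_boolean (⊥ : M).
Proof. exact: mv_oplus0. Qed.

Definition max_clopen b : set (MaxSpec M) := [set m | st b m = 1].

Lemma boolean_starE b m : mv_boolean b -> st b m = if `[< max_clopen b m >] then 1 else 0.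
Proof.
move=> bb; case: asboolP => //; rewrite /max_clopen /=.
by case: (boolean_star m bb) => [->|->].
Qed.

Lemma boolean_star_gt0 b m : mv_boolean b -> 0 < st b m <-> max_clopen b m.
Proof.
move=> bb; rewrite /max_clopen /=.
by case: (boolean_star m bb) => ->; split; lra.
Qed.

Lemma max_clopen0 : max_clopen ⊥ = set0.
Proof. by apply/seteqP; split=> m //; rewrite /max_clopen /= star0; lra. Qed.

Lemma max_clopen1 : max_clopen ⊤ = setT.
Proof. by apply/seteqP; split=> m //; rewrite /max_clopen /= star1. Qed.

Lemma max_clopen_join a b : max_clopen (mv_join a b) = max_clopen a `|` max_clopen b.
Proof.
apply/seteqP; split=> m; rewrite /max_clopen /setU /= star_join;
  have := star_le1 R a m; have := star_le1 R b m; rewrite /Order.max; case: ltP => ?.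
- by right.
- by left.
- by move=> ? ? [?|?]; lra.
- by move=> ? ? [?|?]; lra.
Qed.

Lemma max_clopen_meet a b : max_clopen (mv_meet a b) = max_clopen a `&` max_clopen b.
Proof.
apply/seteqP; split=> m; rewrite /max_clopen /setI /= star_meet;
  have := star_le1 R a m; have := star_le1 R b m; rewrite /Order.min; case: ltP => ?.
- by move=> ? ? ?; split; lra.
- by move=> ? ? ?; split; lra.
- by move=> ? ? []; lra.
- by move=> ? ? []; lra.
Qed.

Lemma max_clopen_neg b : mv_boolean b -> max_clopen (¬ b) = ~` max_clopen b.
Proof.
move=> bb; apply/seteqP; split=> m; rewrite /max_clopen /setC /= starN.
  by move=> ? ?; lra.
by have [->|->] := boolean_star m bb; lra.
Qed.

Lemma max_open_clopen b : mv_boolean b -> max_open (max_clopen b).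
Proof.
move=> bb; apply/(@max_openP R) => m bm; exists b.
by split=> [|m']; move/(boolean_star_gt0 _ bb): bm => // _ /boolean_star_gt0; apply.
Qed.

End BooleanStar.

Section Complete.
Variables (R : realType) (M : mvalg).
Hypothesis Mc : mv_complete M.
Implicit Types (a b c d e t x : M) (m : MaxSpec M).
Local Notation st := (@mvstar R M).
Local Notation clopen := (@max_clopen R M).

Lemma mv_muln_top_disjoint n e d : mv_muln n e = ⊤ -> mv_meet d e = ⊥ -> d = ⊥.
Proof.
move=> n1; rewrite mv_meetC => /(mv_disjoint_muln n); rewrite n1 mv_meetC => <-.
by rewrite mv_meet_odot mv_oplus_one mv_odot1.
Qed.

Lemma mv_notin_all_maximal e : (forall m, ~ proj1_sig m e) -> exists n, mv_muln n e = ⊤.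
Proof.
move=> he; have I0 : mv_ideal [set (⊥ : M)].
  split=> //= [x y xy y0|x y -> ->]; last by rewrite mv_oplus0.
  by apply: mv_le0; rewrite -y0.
have [[i [n [-> h]]]|h] := pselect (mv_adjoin [set (⊥ : M)] e ⊤).
  by exists n; apply: mv_1le; rewrite -[X in _ ⊑ X]mv_0oplus.
have [m hm] := mv_exists_maximal (mv_ideal_adjoin e I0) h.
by case: (he m); apply: hm; exact: mv_in_adjoin.
Qed.

(* If [a] is infinitesimal, then [c = sup n a] lies below [¬ a] and absorbs
   [a], so [a = 0] by cancellation. *)
Lemma complete_semisimple a : (forall m, proj1_sig m a) -> a = ⊥.
Proof.
move=> am.
(* The element [na ⊕ a] lies in every maximal ideal, so its negation lies in none and has a multiple
   equal to [⊤]; being disjoint from that negation, [na ⊙ a] vanishes. *)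
have na n : mv_muln n a ⊑ ¬ a.
  apply/mv_odot_eq0; have [|k k1] := @mv_notin_all_maximal (¬ (mv_muln n a ⊕ a)).
    move=> m em; have [mI _ _] := proj2_sig m; have [_ _ mU] := mI.
    apply: (mv_maximal_one (proj2_sig m)); rewrite -(mv_negoplus (mv_muln n a ⊕ a)).
    apply: (mU _ _ em); apply: mU (am m); exact: mv_ideal_muln.
  exact: mv_muln_top_disjoint k1 (mv_odot_negoplus_disjoint _ _).
have [c [cub club]] := Mc [set mv_muln n a | n in setT].
have ac : a ⊑ c by rewrite -[a]mv_oplus0; apply: cub; exists 1%N.
have cna : c ⊑ ¬ a by apply: club => _ [n _ <-].
have cac : c ⊑ c ⊙ ¬ a.
  apply: club => _ [n _ <-]; rewrite -(mv_oplusK (na n)); apply: mv_le_odot2r.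
  by apply: cub; exists n.+1 => //=; rewrite mv_oplusC.
have e : c ⊕ a = c.
  by rewrite [RHS](mv_le_split ac) -(mv_le_anti cac (mv_odot_lel _ _)) mv_oplusC.
have /mv_oplusK : a ⊑ ¬ c by rewrite -mv_le_neg mv_negK.
by rewrite mv_oplusC e mv_odotneg.
Qed.

Lemma star_leP a b : (forall m, st a m <= st b m) -> a ⊑ b.
Proof.
move=> ab; rewrite -[b]mv_negK; apply/mv_odot_eq0/complete_semisimple => m.
by apply/(star_eq0 R); rewrite starM starN; have := ab m; minmax_lra.
Qed.

Lemma star_inj a b : (forall m, st a m = st b m) -> a = b.
Proof. by move=> ab; apply: mv_le_anti; apply: star_leP => m; rewrite ab. Qed.

Lemma boolean_of_star b : (forall m, st b m = 0 \/ st b m = 1) -> mv_boolean b.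
Proof. by move=> h; apply: star_inj => m; rewrite starD; case: (h m) => ->; minmax_lra. Qed.

Lemma boolean_neg b : mv_boolean b -> mv_boolean (¬ b).
Proof.
move=> bb; apply: boolean_of_star => m; rewrite starN.
by case: (boolean_star R m bb) => ->; [right|left]; lra.
Qed.

Lemma boolean_join b c : mv_boolean b -> mv_boolean c -> mv_boolean (mv_join b c).
Proof.
move=> bb cb; apply: boolean_of_star => m; rewrite star_join /Order.max.
by case: ltP => _; exact: boolean_star.
Qed.

Lemma boolean_meet b c : mv_boolean b -> mv_boolean c -> mv_boolean (mv_meet b c).
Proof.
move=> bb cb; apply: boolean_of_star => m; rewrite star_meet /Order.min.
by case: ltP => _; exact: boolean_star.
Qed.

Lemma boolean_le b a : mv_boolean b -> (forall m, clopen b m -> st a m = 1) -> b ⊑ a.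
Proof.
move=> bb h; apply: star_leP => m; case: (boolean_star R m bb) => [->|bm].
  exact: star_ge0.
by rewrite bm h.
Qed.

Lemma max_clopen_sub b c : mv_boolean b -> clopen b `<=` clopen c -> b ⊑ c.
Proof. by move=> bb bc; apply: boolean_le. Qed.

(* [b] is the supremum of the polar of [e]. *)
Lemma boolean_separation t e : (forall m, st t m = 0 \/ st e m = 0) ->
  exists b, [/\ mv_boolean b, forall m, 0 < st t m -> st b m = 1 &
    forall m, 0 < st e m -> st b m = 0].
Proof.
move=> te; pose E := [set x | forall m, 0 < st e m -> st x m = 0].
have [b [bub blub]] := Mc E.
have Eb : E b.
  (* The supremum is not computed pointwise, so an upper bound of [E] vanishing at [m] is needed:
     [¬ (n e)] is one as soon as [n e] reaches 1 at [m]. *)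
  move=> m em; have [n n1] : exists n, st (mv_muln n e) m = 1.
    exists (Num.bound (st e m)^-1); apply: (hom01_muln_gt0 (mvstar_hom R m)) => //.
    rewrite -ler_pdivrMr // div1r ltW //; apply: archi_boundP.
    by rewrite invr_ge0 ltW.
  have : b ⊑ ¬ mv_muln n e.
    apply: blub => x Ex; apply: star_leP => m'; rewrite starN.
    have := star_ge0 R e m'; rewrite le_eqVlt => /orP[/eqP e0|/Ex ->].
      suff -> : st (mv_muln n e) m' = 0 by rewrite subr0; exact: star_le1.
      by elim: (n) => [|k IH] /=; rewrite ?star0 // starD IH -e0; minmax_lra.
    by have := star_le1 R (mv_muln n e) m'; lra.
  move=> /(star_le R m); rewrite starN n1; have := star_ge0 R b m; lra.
have bb : mv_boolean b.
  apply: mv_le_anti; last exact: mv_le_oplusr.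
  by apply: bub => m /Eb bm; rewrite starD bm; minmax_lra.
exists b; split=> // m tm; have [b0|//] := boolean_star R m bb.
have /(star_le R m) : t ⊑ b by apply: bub => m' em'; have [//|e0] := te m'; lra.
lra.
Qed.

(** Wherever some member of [B] is 1, so is [c], and subtracting [c ∧ ¬ c] costs nothing there. The
    reduced element is thus still an upper bound, which forces [c ∧ ¬ c] to vanish. *)
Lemma boolean_sup (B : set M) : (forall b, B b -> mv_boolean b) ->
  exists c, [/\ mv_boolean c, forall b, B b -> b ⊑ c &
    forall u, (forall b, B b -> b ⊑ u) -> c ⊑ u].
Proof.
move=> Bb; have [c [cub club]] := Mc B.
exists c; split=> //; apply: boolean_of_star => m.
have : c ⊑ c ⊙ ¬ mv_meet c (¬ c).
  apply: club => b bB; apply: boolean_le; first exact: Bb.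
  move=> m' bm; have : st c m' = 1.
    have := star_le R m' (cub b bB); rewrite bm => h.
    by have := star_le1 R c m'; lra.
  by move=> c1; rewrite starM starN star_meet starN c1; minmax_lra.
move=> /(star_le R m); rewrite starM starN star_meet starN.
have := star_ge0 R c m; have := star_le1 R c m.
by minmax_cases; solve [left; lra | right; lra].
Qed.

Lemma boolean_base (O : set (MaxSpec M)) m : max_open O -> O m ->
  exists b, [/\ mv_boolean b, clopen b m & clopen b `<=` O].
Proof.
move=> /(@max_openP R) Oo /Oo[a [am aO]].
pose n := Num.bound (st a m)^-1; pose x := mv_muln n a.
have x1 : st x m = 1.
  apply: (hom01_muln_gt0 (mvstar_hom R m)) => //.
  rewrite -ler_pdivrMr // div1r ltW //; apply: archi_boundP.
  by rewrite invr_ge0 ltW.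
(* These two elements are positive where [x] is above, respectively below, 1/2; the point [m] is on
   the first side and the zeros of [a] are on the second. *)
have [|b [bb b1 b0]] := @boolean_separation (x ⊙ x) (¬ x ⊙ ¬ x).
  move=> m'; rewrite !starM starN; have := star_ge0 R x m'; have := star_le1 R x m'.
  by rewrite /Order.max; case: ltP => ?; case: ltP => ? ? ?; [left; lra|right|left|left].
exists b; split=> //; first by apply: b1; rewrite starM x1; minmax_lra.
move=> m' bm; apply: aO; rewrite lt_neqAle star_ge0 andbT; apply/eqP => a0.
have x0 : st x m' = 0.
  by rewrite /x; elim: (n) => [|k IH] /=; rewrite ?star0 // starD IH -a0; minmax_lra.
have : st b m' = 0 by apply: b0; rewrite starM starN x0; minmax_lra.
by rewrite bm; lra.
Qed.

Lemma boolean_interpolation (K O : set (MaxSpec M)) : max_open (~` K) -> max_open O ->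
  K `<=` O -> exists b, [/\ mv_boolean b, K `<=` clopen b & clopen b `<=` O].
Proof.
move=> Kc Oo KO; pose I := option {b : M | mv_boolean b /\ clopen b `<=` O}.
(* The extra index [None] completes a cover of [K] to one of the compact space; only the other
   indices enter the join. *)
pose F (i : I) := if i is Some b then clopen (proj1_sig b) else ~` K.
have [|m _|D Df DF] := @max_spec_compact M I F.
- by case=> [[b [bb bO]]|//]; exact: max_open_clopen.
- have [Km|Km] := pselect (K m); last by exists None.
  have [b [bb bm bO]] := boolean_base Oo (KO _ Km).
  by exists (Some (exist _ b (conj bb bO))).
suff [b [bb bO Eb]] : exists b, [/\ mv_boolean b, clopen b `<=` O &
    forall m, (exists2 i, (D `&` [set~ None]) i & F i m) -> clopen b m].
  exists b; split=> // m Km; apply: Eb.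
  have [[c|] Di Fi] := DF m Logic.I; last by case: Fi.
  by exists (Some c).
have {DF} : finite_set D by [].
move: D {Df}; apply: finite_set_induct => [|A [[c [cb cO]]|] [b [bb bO Ab]]].
- exists ⊥; split; [exact: boolean0|by rewrite max_clopen0|].
  by move=> m [? []].
- exists (mv_join b c); split; first exact: boolean_join.
    by rewrite max_clopen_join => m [/bO|/cO].
  rewrite max_clopen_join => m [i [[->|Ai] iN] Fi]; first by right.
  by left; apply: Ab; exists i.
- exists b; split=> // m [i [[->|Ai] iN] Fi]; first by case: iN.
  by apply: Ab; exists i.
Qed.

End Complete.

(** * Exhaustivity *)

Definition mv_state (R : realType) (M : mvalg) (s : M -> R) : Prop :=
  [/\ forall a, 0 <= s a, s ⊤ = 1 &
      forall a b, a ⊙ b = ⊥ -> s (a ⊕ b) = s a + s b].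

Section State.
Variables (R : realType) (M : mvalg) (s : M -> R) (ss : mv_state s).
Implicit Types a b : M.

Lemma state_ge0 a : 0 <= s a.
Proof. by case: ss. Qed.

Lemma stateD a b : a ⊙ b = ⊥ -> s (a ⊕ b) = s a + s b.
Proof. by case: ss => _ _; exact. Qed.

Lemma state1 : s ⊤ = 1.
Proof. by case: ss. Qed.

Lemma state0 : s ⊥ = 0.
Proof. by have := stateD (mv_odot0 ⊥); rewrite mv_oplus0; lra. Qed.

Lemma state_split a b : a ⊑ b -> s b = s a + s (b ⊙ ¬ a).
Proof.
move=> ab; rewrite [in LHS](mv_le_split ab) stateD //.
by rewrite mv_odotC mv_odotA [¬ a ⊙ a]mv_odotC mv_odotneg mv_odot0.
Qed.

Lemma state_le a b : a ⊑ b -> s a <= s b.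
Proof. by move=> /state_split ->; rewrite lerDl state_ge0. Qed.

Lemma state_le1 a : s a <= 1.
Proof. by rewrite -state1; exact/state_le/mv_le1. Qed.

Lemma state_joinI a b : s (mv_join a b) + s (mv_meet a b) = s a + s b.
Proof.
rewrite mv_join_odot stateD; last first.
  by rewrite mv_odotC mv_odotA [¬ b ⊙ b]mv_odotC mv_odotneg mv_odot0.
rewrite (state_split (mv_odot_lel a (¬ b))) mv_neg_odot mv_negK -mv_meet_odot; lra.
Qed.

Lemma state_oplus_le a b : s (a ⊕ b) <= s a + s b.
Proof.
have ab := mv_le_oplusr a b; rewrite (state_split ab) lerD2l; apply: state_le.
by apply/mv_resid_neg; exact: mv_le_refl.
Qed.

End State.

(** If [a ⊙ b = ⊥] then [b ⊑ ¬ a], so (P1) reads [p (a ⊕ b) = p a ⊕ p b]; by monotonicity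
    [p b ⊑ ¬ p a], and the truncation in this sum is not reached. *)
Lemma probability_map_state (R : realType) (M N : mvalg) (p : M -> N) (y : MaxSpec N) :
  probability_map p -> mv_state (fun a => mvstar R (p a) y).
Proof.
move=> [pD pN p1]; have ple a b : a ⊑ b -> p a ⊑ p b.
  by move=> ab; rewrite (mv_le_split ab) pD; exact: mv_le_oplusr.
split=> [a||a b ab]; [exact: star_ge0|by rewrite p1 star1|].
have ba : b ⊑ ¬ a by apply/mv_odot_eq0; rewrite mv_odotC.
rewrite pD (mv_le_meetP _ _).1 // starD.
by have := star_le R y (ple _ _ ba); rewrite pN starN; minmax_lra.
Qed.

(* If no row of an infinite partition of [nat] into infinite rows is a suitable
   range for [f], picking a bad index in each row gives a sequence along which
   the total masses have dropped by [d]; this happens at most [K] times. *)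
Lemma rosenthal (R : realType) (d : R) (K : nat) (m : nat -> set nat -> R) :
  (forall j A, 0 <= m j A) ->
  (forall j A B, A `<=` B -> m j A <= m j B) ->
  (forall j A B, A `&` B = set0 -> m j A + m j B <= m j (A `|` B)) ->
  (forall j, m j setT < K.+1%:R * d) ->
  exists2 f : nat -> nat, injective f &
    forall j, m (f j) (f @` (~` [set j])) < d.
Proof.
elim: K m => [|K IH] m m0 mle mD mT.
  exists id => // j; have := mT j; rewrite mul1r.
  by apply: le_lt_trans; exact: mle.
pose q (k i : nat) : nat := pickle (k, i).
have q_inj k i l j : q k i = q l j -> k = l /\ i = j.
  by rewrite /q => /(pcan_inj pickleK); case.
have [[k kd]|nk] := pselect (exists k, forall i, m (q k i) (q k @` (~` [set i])) < d).
  by exists (q k) => // i j /q_inj[].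
have /choice[g gd] k : exists i, d <= m (q k i) (q k @` (~` [set i])).
  apply: contrapT => h; apply: nk; exists k => i.
  by rewrite ltNge; apply/negP => h'; apply: h; exists i.
pose c k := q k (g k).
have c_inj : injective c by move=> i j /q_inj[].
have [|||j|f f_inj fd] := IH (fun k A => m (c k) (c @` A)).
- by move=> *; exact: m0.
- by move=> j A B AB; apply: mle; exact: image_subset.
- move=> j A B AB; rewrite image_setU; apply: mD; apply/seteqP; split=> // x.
  move=> [[a Aa <-] [b Bb /c_inj ba]]; rewrite ba in Bb.
  by have : (A `&` B) a by []; rewrite AB.
- have : m (c j) (c @` setT) + m (c j) (q j @` (~` [set g j])) <= m (c j) setT.
    apply: le_trans (mle _ _ _ (@subsetT _ _)); apply: mD.
    apply/seteqP; split=> // x [[a _ <-] [i ij /q_inj[aj]]].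
    by rewrite -aj => /ij.
  have := gd j; rewrite -/(c j); have := mT (c j).
  rewrite -[K.+2%:R]natr1 mulrDl mul1r; lra.
exists (c \o f) => [i j /c_inj/f_inj//|j] /=.
by have := fd j; rewrite /= image_comp.
Qed.

Lemma injective_unbounded (f : nat -> nat) n : injective f -> exists j, (n <= f j)%N.
Proof.
move=> f_inj; apply: contrapT => h.
have fn j : (f j < n)%N by rewrite ltnNge; apply/negP => nf; apply: h; exists j.
have g_inj : injective (fun i : 'I_n.+1 => Ordinal (fn i)).
  by move=> i j [/f_inj/val_inj].
by have := leq_card _ g_inj; rewrite !card_ord ltnn.
Qed.

(** * Exhaustivity uniformly over a family of states *)

Section Family.
Variables (R : realType) (M : mvalg) (Mc : mv_complete M).
Variables (Y : Type) (s : Y -> M -> R).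
Hypothesis s_state : forall y, mv_state (s y).
Hypothesis s_seq : forall y : nat -> Y, exists2 f : nat -> nat, injective f &
  forall a (e : R), 0 < e -> exists n, forall i j, (n <= i)%N -> (n <= j)%N ->
    `|s (y (f i)) a - s (y (f j)) a| < e.
Local Notation clopen := (@max_clopen R M).
Implicit Types (a b c : M) (e : R).

(** [c A] is the supremum of the [b k] with [k] in [A]. Residuation carries disjointness from the
    [b k] to the suprema, so composing a state with [c] gives a monotone superadditive set function,
    as Rosenthal's lemma requires. *)
Lemma disjoint_boolean_sup (b : nat -> M) : (forall k, mv_boolean (b k)) ->
  (forall i j, i <> j -> b i ⊙ b j = ⊥) ->
  exists c : set nat -> M, [/\ forall k A, A k -> b k ⊑ c A,
    forall A B, A `<=` B -> c A ⊑ c B &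
    forall A B, A `&` B = set0 -> c A ⊙ c B = ⊥ /\ c A ⊕ c B ⊑ c (A `|` B)].
Proof.
move=> bb bdisj.
have /choice[c hc] A : exists c, [/\ mv_boolean c, forall k, A k -> b k ⊑ c &
    forall u, (forall k, A k -> b k ⊑ u) -> c ⊑ u].
  have [|c [cb cub club]] := boolean_sup R Mc (B := b @` A).
    by move=> _ [k _ <-].
  exists c; split=> //; first by move=> k Ak; apply: cub; exists k.
  by move=> u uA; apply: club => _ [k Ak <-]; exact: uA.
have cmono A B : A `<=` B -> c A ⊑ c B.
  move=> AB; have [_ _] := hc A; apply=> k /AB Bk.
  by have [_ + _] := hc B; exact.
exists c; split=> //; first by move=> k A Ak; have [_ + _] := hc A; exact.
move=> A B AB; have dAB : c A ⊙ c B = ⊥.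
  apply/mv_odot_eq0; have [_ _] := hc A; apply=> i Ai.
  rewrite -mv_le_neg mv_negK; have [_ _] := hc B; apply=> j Bj.
  apply/mv_odot_eq0/bdisj => ji; rewrite ji in Bj.
  by have : (A `&` B) i by []; rewrite AB.
split=> //; apply: (star_leP (R := R)) => // m.
have [cAb _ _] := hc A; have [cBb _ _] := hc B.
have := star_le R m (cmono A (A `|` B) (@subsetUl _ _ _)).
have := star_le R m (cmono B (A `|` B) (@subsetUr _ _ _)).
have : mvstar R (c A ⊙ c B) m = 0 by rewrite dAB star0.
rewrite starM starD.
by case: (boolean_star R m cAb) => ->; case: (boolean_star R m cBb) => ->; minmax_lra.
Qed.

Lemma no_persistent_disjoint_booleans (b : nat -> M) (t : nat -> M -> R) e :
  0 < e -> (forall k, mv_boolean (b k)) ->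
  (forall i j, i <> j -> b i ⊙ b j = ⊥) ->
  (forall k, mv_state (t k)) ->
  (forall a d, 0 < d -> exists n, forall i j, (n <= i)%N -> (n <= j)%N ->
     `|t i a - t j a| < d) ->
  ~ (forall k, e <= t k (b k)).
Proof.
move=> e0 bb bdisj ts tc te.
have [c [cub cmono cD]] := disjoint_boolean_sup bb bdisj.
(* This makes (K+1)e/3 exceed 1, the total mass of a state. *)
pose K := Num.bound (3 / e).
have [|||j|f f_inj fd] := @rosenthal R (e / 3) K (fun j A => t j (c A)).
- by move=> *; exact: state_ge0.
- by move=> j A B AB; apply: state_le => //; exact: cmono.
- by move=> j A B /cD[dAB /(state_le (ts j))]; rewrite stateD.
- apply: le_lt_trans (state_le1 (ts j) _) _.
  have : 3 / e < K.+1%:R.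
    apply: lt_trans (archi_boundP _) _; last by rewrite ltr_nat.
    by rewrite divr_ge0 // ltW.
  by rewrite ltr_pdivrMr //; lra.
(* On [c A] the states at even positions are at least e, while those at odd positions are below e/3,
   since [A] omits their own index. Both parities occur arbitrarily far out, which excludes
   convergence. *)
pose A := f @` [set j | ~~ odd j].
have e3 : 0 < e / 3 by lra.
have [n nP] := tc (c A) _ e3.
have [i ni] : exists j, (n <= f j.*2)%N.
  by apply: (@injective_unbounded (f \o double)) => i j /= /f_inj/double_inj.
have [j nj] : exists j, (n <= f j.*2.+1)%N.
  by apply: (@injective_unbounded (f \o (S \o double))) => k l /= /f_inj[]/double_inj.
have := nP _ _ ni nj.
have : e <= t (f i.*2) (c A).
  apply: le_trans (te _) _; apply: state_le => //; apply: cub.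
  by exists i.*2 => //=; rewrite odd_double.
have : t (f j.*2.+1) (c A) < e / 3.
  apply: le_lt_trans (fd _); apply: state_le => //; apply: cmono.
  by move=> _ [k ko <-]; exists k => //= kj; rewrite kj /= odd_double in ko.
rewrite ltr_norml => ? ? /andP[]; lra.
Qed.

(** If no such [b] existed, greedy choices would keep finding a Boolean inside [O], disjoint from
    the join of the earlier ones and of mass above e for some [y]; [s_seq] makes these states
    converge along a sequence. *)
Lemma boolean_exhaustion (O : set (MaxSpec M)) e : 0 < e ->
  exists b, [/\ mv_boolean b, clopen b `<=` O &
    forall c, mv_boolean c -> clopen c `<=` O -> c ⊙ b = ⊥ ->
      forall y, s y c <= e].
Proof.
move=> e0; apply: contrapT => h.
pose X := {b : M | mv_boolean b /\ clopen b `<=` O}.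
have /choice[g hg] (x : X) : exists cy : M * Y,
    [/\ mv_boolean cy.1, clopen cy.1 `<=` O, cy.1 ⊙ proj1_sig x = ⊥ & e < s cy.2 cy.1].
  case: x => b [bb bO]; apply: contrapT => h'; apply: h; exists b; split=> //.
  move=> c cb cO cd y; rewrite leNgt; apply/negP => ec; apply: h'.
  by exists (c, y).
have step_proof (x : X) : mv_boolean (mv_join (proj1_sig x) (g x).1) /\
    clopen (mv_join (proj1_sig x) (g x).1) `<=` O.
  have [gb gO _ _] := hg x; case: (x) gb gO => b [bb bO] /= gb gO.
  split; first exact: boolean_join.
  by rewrite max_clopen_join => m [/bO|/gO].
pose step x : X := exist _ _ (step_proof x).
have x0_proof : mv_boolean (⊥ : M) /\ clopen ⊥ `<=` O.
  by split; [exact: boolean0|rewrite max_clopen0].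
pose x n := iter n step (exist _ _ x0_proof).
pose b n := (g (x n)).1.
have xle n k : proj1_sig (x n) ⊑ proj1_sig (x (n + k)%N).
  elim: k => [|k IH]; first by rewrite addn0; exact: mv_le_refl.
  by rewrite addnS; apply: mv_le_trans IH (mv_le_joinl _ _).
have bx n : b n ⊑ proj1_sig (x n.+1) by exact: mv_le_joinr.
have bdisj_lt i j : (i < j)%N -> b j ⊙ b i = ⊥.
  move=> ij; apply/mv_odot_eq0.
  have [_ _ /mv_odot_eq0 h' _] := hg (x j); apply: mv_le_trans h' _.
  by rewrite mv_le_neg; apply: mv_le_trans (bx i) _; rewrite -(subnKC ij).
have bdisj i j : i <> j -> b i ⊙ b j = ⊥.
  by move=> /eqP; rewrite neq_ltn => /orP[/bdisj_lt|/bdisj_lt//]; rewrite mv_odotC.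
have [f f_inj fc] := s_seq (fun n => (g (x n)).2).
apply: (@no_persistent_disjoint_booleans (b \o f)
  (fun k => s (g (x (f k))).2) e) => //.
- by move=> k; have [] := hg (x (f k)).
- by move=> i j ij; apply: bdisj => /f_inj.
- by move=> k /=; have [_ _ _ /ltW] := hg (x (f k)).
Qed.

End Family.

(** Compactness supplies a cluster point [z]; the balls of radius 1/(n+1) around it then select a
    convergent subsequence. *)
Lemma metrisable_seq_cluster (R : realType) (N : mvalg) (y : nat -> MaxSpec N) :
  max_metrisable R N -> exists2 f : nat -> nat, injective f &
    forall g : MaxSpec N -> R, max_continuous g -> forall e : R, 0 < e ->
      exists n, forall i j, (n <= i)%N -> (n <= j)%N ->
        `|g (y (f i)) - g (y (f j))| < e.
Proof.
move=> [d [d0 dE dC dT dO]].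
have [z zP] : exists z, forall (e : R), 0 < e -> forall n, exists k,
    (n <= k)%N /\ d z (y k) < e.
  apply: contrapT => h.
  have /choice[en en_far] z : exists en : R * nat, 0 < en.1 /\
      forall k, (en.2 <= k)%N -> en.1 <= d z (y k).
    apply: contrapT => h'; apply: h; exists z => e e0 n.
    apply: contrapT => h''; apply: h'; exists (e, n); split=> //= k nk.
    by rewrite leNgt; apply/negP => dk; apply: h''; exists k.
  have [z|z _|D Df cov] := @max_spec_compact N _ (fun z => [set w | d z w < (en z).1]).
  - apply/dO => w /= zw; exists ((en z).1 - d z w); first by rewrite subr_gt0.
    by move=> v /= wv; have := dT z w v; lra.
  - by exists z => //=; rewrite (dE z z).2 //; have [] := en_far z.
  have [n nP] : exists n, forall z, D z -> ((en z).2 <= n)%N.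
    move: D Df {cov}; apply: finite_set_induct => [|A z [n nA]]; first by exists 0%N.
    exists (maxn n (en z).2) => w [->|/nA]; rewrite leq_max ?leqnn ?orbT //.
    by move=> ->.
  have [z Dz /=] := cov (y n) Logic.I.
  by have [_ /(_ _ (nP _ Dz))] := en_far z; rewrite leNgt => /negP.
have /choice[k kP] (en : nat * nat) : exists k, (en.2 <= k)%N /\ d z (y k) < en.1.+1%:R^-1.
  by apply: zP; rewrite invr_gt0 ltr0n.
have [f [fS fd]] : exists f : nat -> nat, (forall n, (f n < f n.+1)%N) /\
    (forall n, d z (y (f n)) < n.+1%:R^-1).
  exists (fix f n := if n is n'.+1 then k (n, (f n').+1) else k (0%N, 0%N)).
  split=> n; first exact: (kP (n.+1, _)).1.
  by case: n => [|n]; [exact: (kP (0%N, _)).2|exact: (kP (n.+1, _)).2].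
have f_lt i j : (i < j)%N -> (f i < f j)%N.
  by apply: (@homo_ltn _ f (fun a b => is_true (a < b)%N)) => // ? ? ?; exact: ltn_trans.
exists f.
  move=> i j fij; apply/eqP; rewrite eqn_leq.
  by apply/andP; split; rewrite leqNgt; apply/negP => /f_lt; rewrite fij ltnn.
move=> g /max_continuousP gc e e0.
have [V [Vo Vz Vg]] := gc z (e / 2) ltac:(lra).
have [r r0 rV] := (dO V).1 Vo z Vz.
exists (Num.bound r^-1) => i j ni nj.
have near l : (Num.bound r^-1 <= l)%N -> `|g (y (f l)) - g z| < e / 2.
  move=> nl; apply: Vg; apply: rV => /=; apply: lt_trans (fd l) _.
  rewrite -[ltRHS]invrK ltf_pV2 ?posrE ?invr_gt0 ?ltr0n //.
  apply: lt_le_trans (archi_boundP _) _; first by rewrite invr_ge0 ltW.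
  by rewrite ler_nat leqW.
have := near i ni; have := near j nj; rewrite !ltr_norml.
by move=> /andP[? ?] /andP[? ?]; apply/andP; split; lra.
Qed.

(** * Extension to Borel sets *)

Lemma halves_sum (R : realType) (e : R) n :
  \sum_(k < n) e / 2 ^+ k.+1 = e - e / 2 ^+ n.
Proof.
elim: n => [|n IH]; first by rewrite big_ord0 expr0 divr1 subrr.
rewrite big_ord_recr /= IH exprS invfM; set v := (2 ^+ n)^-1; lra.
Qed.

Section Extension.
Variables (R : realType) (M : mvalg) (Mc : mv_complete M).
Variables (Y : Type) (s : Y -> M -> R).
Hypothesis s_state : forall y, mv_state (s y).
Hypothesis s_seq : forall y : nat -> Y, exists2 f : nat -> nat, injective f &
  forall a (e : R), 0 < e -> exists n, forall i j, (n <= i)%N -> (n <= j)%N ->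
    `|s (y (f i)) a - s (y (f j)) a| < e.
Local Notation clopen := (@max_clopen R M).
Implicit Types (a b c : M) (d e : R) (A B E W : set (MaxSpec M)) (y : Y).

Definition open_small W e := forall b, mv_boolean b -> clopen b `<=` W ->
  forall y, s y b <= e.

(** A Borel set with empty interior contains no nonempty clopen set, so its size has to be read off
    open supersets. *)
Definition small E e := exists W, [/\ max_open W, E `<=` W & open_small W e].

Lemma open_smallS A B d e : B `<=` A -> d <= e -> open_small A d -> open_small B e.
Proof. by move=> BA de h b bb bB y; apply: le_trans de; apply: h => //; exact: subset_trans BA. Qed.

Lemma open_small0 : open_small set0 0.
Proof.
move=> b bb b0 y; have -> : b = ⊥ by apply/mv_le0/(max_clopen_sub Mc bb)/(subset_trans b0).
by rewrite state0.
Qed.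

(** A clopen [b] inside the union is cut in two: interpolating a clopen [c] between the closed set
    [b \ W2] and [W1] leaves [b ∧ ¬ c] inside [W2]. *)
Lemma open_smallU W1 W2 d e : max_open W1 -> max_open W2 ->
  open_small W1 d -> open_small W2 e -> open_small (W1 `|` W2) (d + e).
Proof.
move=> o1 o2 h1 h2 b bb bW y.
have [|||c [cb bc cW]] := @boolean_interpolation R M Mc (clopen b `\` W2) W1.
- rewrite setCD -max_clopen_neg //; apply: (max_openU R) => //.
  by apply/max_open_clopen/(boolean_neg R Mc bb).
- by [].
- by move=> m [/bW[]].
have ncb := boolean_neg R Mc cb.
have db := boolean_meet R Mc bb ncb.
apply: le_trans (lerD (h1 c cb cW y) (h2 (mv_meet b (¬ c)) db _ y)).
  apply: le_trans (state_oplus_le (s_state y) _ _); apply: state_le => //.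
  apply: (boolean_le (R := R)) => // m bm; have := bm; rewrite /max_clopen /= => b1.
  by rewrite starD star_meet starN b1; case: (boolean_star R m cb) => ->; minmax_lra.
rewrite max_clopen_meet max_clopen_neg // => m [bm cm].
by apply: contrapT => Wm; apply/cm/bc.
Qed.

Lemma open_small_bigcup (W : nat -> set (MaxSpec M)) (d : nat -> R) e :
  (forall k, max_open (W k)) -> (forall k, open_small (W k) (d k)) ->
  (forall n, \sum_(k < n) d k <= e) -> open_small (\bigcup_k W k) e.
Proof.
move=> Wo Wd de.
pose V n : set (MaxSpec M) := [set m | exists2 k, (k < n)%N & W k m].
have VS n : V n.+1 = V n `|` W n.
  apply/seteqP; split=> m.
    move=> [k]; rewrite ltnS leq_eqVlt => /orP[/eqP ->|kn] Wm; [by right|by left; exists k].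
  by move=> [[k kn Wm]|Wm]; [exists k => //; exact: ltnW|exists n].
have V0 : V 0%N = set0 by apply/seteqP; split=> m // [].
have Vo n : max_open (V n).
  elim: n => [|n IH]; last by rewrite VS; exact: (max_openU R).
  by rewrite V0; exact: (max_open0 R).
have Vd n : open_small (V n) (\sum_(k < n) d k).
  elim: n => [|n IH]; last by rewrite VS big_ord_recr; exact: open_smallU.
  by rewrite big_ord0 V0; exact: open_small0.
move=> b bb bW y.
pose F (i : option nat) := if i is Some k then W k else ~` clopen b.
have [[k|]|m _|D Df cov] := @max_spec_compact M _ F; first exact: Wo.
- by rewrite /= -max_clopen_neg //; apply/max_open_clopen/(boolean_neg R Mc bb).
- have [bm|bm] := pselect (clopen b m); last by exists None.
  by have [k _ Wm] := bW _ bm; exists (Some k).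
have [n nP] : exists n, forall k, D (Some k) -> (k < n)%N.
  move: D Df {cov}; apply: finite_set_induct => [|A i [n nA]]; first by exists 0%N.
  case: i => [i|]; last by exists n => k [//|/nA].
  exists (maxn n i.+1) => k [[->]|/nA kn]; rewrite leq_max ?leqnn ?orbT //.
  by rewrite kn.
apply: le_trans (Vd n b bb _ y) (de n) => m bm.
have [[k|] Di Fm] := cov m Logic.I; last by case: Fm.
by exists k => //; exact: nP.
Qed.

Lemma smallS A B d e : B `<=` A -> d <= e -> small A d -> small B e.
Proof.
move=> BA de [W [Wo AW Wd]]; exists W; split=> //; first exact: subset_trans AW.
exact: open_smallS Wd.
Qed.

Lemma small0 : small set0 0.
Proof. by exists set0; split=> //; [exact: (max_open0 R)|exact: open_small0]. Qed.

Lemma smallU A B d e : small A d -> small B e -> small (A `|` B) (d + e).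
Proof.
move=> [V [Vo AV Vd]] [W [Wo BW We]]; exists (V `|` W); split.
- exact: (max_openU R).
- exact: setUSS.
- exact: open_smallU.
Qed.

Lemma small_bigcup (A : nat -> set (MaxSpec M)) e : 0 < e ->
  (forall k, small (A k) (e / 2 ^+ k.+1)) -> small (\bigcup_k A k) e.
Proof.
move=> e0 /choice[W WP]; exists (\bigcup_k W k); split.
- by apply: (max_open_bigcup R) => k; have [] := WP k.
- by move=> m [k _ Am]; exists k => //; have [_ + _] := WP k; exact.
- apply: (@open_small_bigcup W (fun k => e / 2 ^+ k.+1)).
  + by move=> k; have [] := WP k.
  + by move=> k; have [] := WP k.
  + by move=> n; rewrite halves_sum gerBl divr_ge0 ?exprn_ge0 // ltW.
Qed.

Definition symdiff A B := (A `\` B) `|` (B `\` A).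

Definition approx A b e := mv_boolean b /\ small (symdiff A (clopen b)) e.

Definition approximable A := forall e, 0 < e -> exists b, approx A b e.

Lemma approx_clopen b : mv_boolean b -> approx (clopen b) b 0.
Proof. by move=> bb; split=> //; rewrite /symdiff setDv setU0; exact: small0. Qed.

Lemma approxU A B b c d e : approx A b d -> approx B c e ->
  approx (A `|` B) (mv_join b c) (d + e).
Proof.
move=> [bb Ab] [cb Bc]; split; first exact: (boolean_join R Mc).
apply: smallS (smallU Ab Bc) => //; rewrite max_clopen_join => m.
have [?|?] := pselect (A m);
have [?|?] := pselect (B m);
have [?|?] := pselect (clopen b m);
have [?|?] := pselect (clopen c m);
rewrite /symdiff /setU /setD /=; tauto.
Qed.

Lemma approxC A b e : approx A b e -> approx (~` A) (¬ b) e.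
Proof.
move=> [bb Ab]; split; first exact: boolean_neg bb.
apply: smallS Ab => //; rewrite max_clopen_neg // => m.
have [?|?] := pselect (A m);
have [?|?] := pselect (clopen b m);
rewrite /symdiff /setU /setD /setC /=; tauto.
Qed.

Lemma approximable_open O : max_open O -> approximable O.
Proof.
move=> Oo e e0; have [b [bb bO bex]] := boolean_exhaustion Mc s_state s_seq O e0.
exists b; split=> //; exists (O `&` clopen (¬ b)); split.
- by apply: (max_openI R) => //; apply/max_open_clopen/(boolean_neg R Mc bb).
- by rewrite max_clopen_neg // => m [//|[/bO]].
- move=> c cb cO y; apply: bex => //; first by move=> m /cO[].
  apply/mv_odot_eq0/(max_clopen_sub Mc cb) => m /cO[]//.
Qed.

Lemma approx_bigcup (A : nat -> set (MaxSpec M)) (b : nat -> M) e : 0 < e ->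
  (forall k, approx (A k) (b k) (e / 2 ^+ k.+1)) ->
  small (symdiff (\bigcup_k A k) (\bigcup_k clopen (b k))) e.
Proof.
move=> e0 Ab.
have : small (\bigcup_k symdiff (A k) (clopen (b k))) e.
  by apply: small_bigcup => // k; have [] := Ab k.
apply: smallS => // m [[[k _ Am] nb]|[[k _ bm] nA]]; exists k => //.
  by left; split=> // bm; apply: nb; exists k.
by right; split=> // Am; apply: nA; exists k.
Qed.

Lemma halves_gt0 e k : 0 < e -> 0 < e / 2 ^+ k.+1.
Proof. by move=> e0; rewrite divr_gt0 // exprn_gt0. Qed.

Lemma symdiff_trans A B E d e : small (symdiff A B) d -> small (symdiff B E) e ->
  small (symdiff A E) (d + e).
Proof.
move=> AB BE; apply: smallS (smallU AB BE) => // m.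
have [?|?] := pselect (A m);
have [?|?] := pselect (B m);
have [?|?] := pselect (E m);
rewrite /symdiff /setU /setD /=; tauto.
Qed.

Lemma approximable_borel A : max_borel A -> approximable A.
Proof.
apply; split; last exact: approximable_open.
split.
- move=> e e0; exists ⊥; split; first exact: boolean0.
  rewrite max_clopen0 /symdiff setDv setU0; exact: smallS (@subset_refl _ _) (ltW e0) small0.
- by move=> B Ba e /Ba[b Bb]; exists (¬ b); rewrite setTD; exact: approxC.
(* Approximating the terms with summable errors only yields an open set, the union of the clopens;
   the open case then returns to a single clopen. *)
- move=> B Ba e e0; have e2 : 0 < e / 2 by lra.
  have /choice[b Bb] k := Ba k _ (halves_gt0 k e2).
  have Uo : max_open (\bigcup_k clopen (b k)).
    by apply: (max_open_bigcup R) => k; apply: max_open_clopen; have [] := Bb k.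
  have [c [cb Uc]] := approximable_open Uo e2.
  exists c; split=> //; rewrite (_ : e = e / 2 + e / 2); last by lra.
  exact: symdiff_trans (approx_bigcup e2 Bb) Uc.
Qed.

Lemma small_clopen b e y : mv_boolean b -> small (clopen b) e -> s y b <= e.
Proof. by move=> bb [W [_ bW We]]; exact: We. Qed.

Lemma approx_close A b c d e y : approx A b d -> approx A c e -> `|s y b - s y c| <= d + e.
Proof.
suff aux b' c' d' e' : approx A b' d' -> approx A c' e' -> s y b' - s y c' <= d' + e'.
  move=> Ab Ac; rewrite ler_norml; have := aux _ _ _ _ Ab Ac.
  by have := aux _ _ _ _ Ac Ab; move=> ? ?; apply/andP; split; lra.
move=> [bb Ab] [cb Ac]; have ncb := boolean_neg R Mc cb.
have db := boolean_meet R Mc bb ncb.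
have : s y (mv_meet b' (¬ c')) <= d' + e'.
  apply: small_clopen => //; apply: smallS (smallU Ab Ac) => //.
  rewrite max_clopen_meet max_clopen_neg // => m [bm cm].
  by have [Am|Am] := pselect (A m); [right; left|left; right].
suff : s y b' <= s y c' + s y (mv_meet b' (¬ c')) by lra.
apply: le_trans (state_oplus_le (s_state y) _ _); apply: state_le => //.
apply: (boolean_le (R := R)) => // m; rewrite /max_clopen /= => b1.
by rewrite starD star_meet starN b1; case: (boolean_star R m cb) => ->; minmax_lra.
Qed.

(** By [approx_close] each lower bound [s y b - e] is below each upper bound [s y c + d], so this
    supremum is within e of [s y b] for every e-approximation [b], uniformly in [y], without
    choosing a sequence. *)
Definition extension A y : R :=
  sup [set r | exists b e, approx A b e /\ r = s y b - e].

Lemma extension_approx A b e y : approx A b e -> `|extension A y - s y b| <= e.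
Proof.
move=> Ab; have ub : ubound [set r | exists b e, approx A b e /\ r = s y b - e] (s y b + e).
  move=> _ [c [d [Ac ->]]]; have := approx_close y Ab Ac.
  by rewrite ler_norml => /andP[? ?]; lra.
have : extension A y <= s y b + e by apply: ge_sup ub; exists (s y b - e), b, e.
have : s y b - e <= extension A y.
  by apply: ub_le_sup; [exists (s y b + e)|exists b, e].
by rewrite ler_norml => ? ?; apply/andP; split; lra.
Qed.

Lemma extension_clopen b y : mv_boolean b -> extension (clopen b) y = s y b.
Proof.
move=> /approx_clopen/extension_approx => /(_ y); rewrite normr_le0.
by rewrite subr_eq0 => /eqP.
Qed.

Lemma extension0 y : extension set0 y = 0.
Proof. by rewrite -(max_clopen0 R) extension_clopen ?state0 //; exact: boolean0. Qed.

Lemma extension_small A e y : small A e -> extension A y <= e.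
Proof.
move=> Ae; have : approx A ⊥ e.
  split; first exact: boolean0.
  by rewrite max_clopen0 /symdiff setD0 set0D setU0.
by move=> /extension_approx => /(_ y); rewrite state0 // subr0 ler_norml => /andP[].
Qed.

Lemma extension_ge0 A y : approximable A -> 0 <= extension A y.
Proof.
move=> Aa; rewrite leNgt; apply/negP => A0.
have [|b /extension_approx Ab] := Aa (- extension A y / 2); first by lra.
have := Ab y.
by rewrite ler_norml => /andP[? ?]; have := state_ge0 (s_state y) b; lra.
Qed.

Lemma extensionT y : extension setT y = 1.
Proof.
rewrite -(max_clopen1 R) extension_clopen; first exact: state1.
by apply: (boolean_of_star Mc (R := R)) => m; right; exact: star1.
Qed.

Lemma extensionU A B y : approximable A -> approximable B -> A `&` B = set0 ->
  extension (A `|` B) y = extension A y + extension B y.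
Proof.
move=> Aa Ba AB; apply/eqP; rewrite -subr_eq0 -normr_le0 leNgt; apply/negP => h.
(* The errors add up to at most six eighths of [z]: two for the join, two for the meet, one each for
   [A] and [B]. *)
set z := `|_| in h; have z8 : 0 < z / 8 by lra.
have [b Ab] := Aa _ z8; have [c Bc] := Ba _ z8.
have [bb Ab'] := Ab; have [cb Bc'] := Bc.
have : s y (mv_meet b c) <= z / 8 + z / 8.
  apply: small_clopen; first exact: (boolean_meet R Mc).
  apply: smallS (smallU Ab' Bc') => //; rewrite max_clopen_meet => m [bm cm].
  have [Am|Am] := pselect (A m); last by left; right.
  right; right; split=> // Bm; suff : (A `&` B) m by rewrite AB.
  by [].
have := state_ge0 (s_state y) (mv_meet b c).
have := extension_approx y Ab; have := extension_approx y Bc.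
have := extension_approx y (approxU Ab Bc).
have := state_joinI (s_state y) b c.
rewrite !ler_norml => ? /andP[? ?] /andP[? ?] /andP[? ?] ? ?.
have : z <= z * 7 / 8 by rewrite /z ler_norml -/z; apply/andP; split; lra.
lra.
Qed.

Lemma approximableU A B : approximable A -> approximable B -> approximable (A `|` B).
Proof.
move=> Aa Ba e e0; have e2 : 0 < e / 2 by lra.
have [b Ab] := Aa _ e2; have [c Bc] := Ba _ e2.
by exists (mv_join b c); rewrite (_ : e = e / 2 + e / 2); [exact: approxU|lra].
Qed.

Lemma approximableC A : approximable A -> approximable (~` A).
Proof. by move=> Aa e /Aa[b Ab]; exists (¬ b); exact: approxC. Qed.

Lemma approximableD A B : approximable A -> approximable B -> approximable (A `\` B).
Proof.
move=> Aa Ba; rewrite -[_ `\` _]setCK setCD setUC.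
by apply: approximableC; apply: approximableU => //; exact: approximableC.
Qed.

Lemma extension_sum (A : nat -> set (MaxSpec M)) n y :
  (forall k, (k < n)%N -> approximable (A k)) -> trivIset [set k | (k < n)%N] A ->
  approximable (\bigcup_(k in [set k | (k < n)%N]) A k) /\
  extension (\bigcup_(k in [set k | (k < n)%N]) A k) y = \sum_(k < n) extension (A k) y.
Proof.
elim: n => [|n IH] Aa At.
  have -> : \bigcup_(k in [set k | (k < 0)%N]) A k = set0.
    by apply/seteqP; split=> m // [].
  rewrite extension0 big_ord0; split=> // e e0; exists ⊥.
  by rewrite -(max_clopen0 R); split; [exact: boolean0|
    apply: smallS small0; [rewrite /symdiff setDv setU0|exact: ltW]].
have [||Ua Us] := IH.
- by move=> k kn; apply: Aa; exact: ltnW.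
- by move=> i j /= ni nj; apply: At => /=; exact: ltnW.
have -> : \bigcup_(k in [set k | (k < n.+1)%N]) A k =
    \bigcup_(k in [set k | (k < n)%N]) A k `|` A n.
  apply/seteqP; split=> m.
    move=> [k /=]; rewrite ltnS leq_eqVlt => /orP[/eqP ->|kn] Am; [by right|by left; exists k].
  by move=> [[k /= kn Am]|Am]; [exists k => //=; exact: ltnW|exists n => /=].
have An : approximable (A n) by apply: Aa.
split; first exact: approximableU.
rewrite extensionU // ?Us ?big_ord_recr //.
apply/seteqP; split=> m // [[k /= kn Ak] An'].
have /eqP := At k n (ltnW kn) (ltnSn n) (ex_intro _ m (conj Ak An')).
by rewrite ltn_eqF.
Qed.

(** The union of the approximating clopens is exhausted up to e/2 by a clopen [c], and compactness
    covers [c] by finitely many of them. A point outside those first [A k] lies in an approximation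
    error or in the part missed by [c]. *)
Lemma small_tail (A : nat -> set (MaxSpec M)) e : (forall k, max_borel (A k)) -> 0 < e ->
  exists n0, forall n, (n0 <= n)%N ->
    small (\bigcup_k A k `\` \bigcup_(k in [set k | (k < n)%N]) A k) e.
Proof.
move=> Ab e0; have e2 : 0 < e / 2 by lra.
have /choice[b bP] k : exists b, approx (A k) b (e / 2 / 2 ^+ k.+1).
  exact: approximable_borel (Ab k) _ (halves_gt0 k e2).
have Uo : max_open (\bigcup_k clopen (b k)).
  by apply: (max_open_bigcup R) => k; apply: max_open_clopen; have [] := bP k.
have [c [cb cO cex]] := boolean_exhaustion Mc s_state s_seq (\bigcup_k clopen (b k)) e2.
pose F (i : option nat) := if i is Some k then clopen (b k) else ~` clopen c.
have [[k|]|m _|D Df cov] := @max_spec_compact M _ F.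
- by apply: max_open_clopen; have [] := bP k.
- by rewrite /= -max_clopen_neg //; apply/max_open_clopen/(boolean_neg R Mc cb).
- have [cm|cm] := pselect (clopen c m); last by exists None.
  by have [k _ bm] := cO _ cm; exists (Some k).
have [n0 n0P] : exists n, forall k, D (Some k) -> (k < n)%N.
  move: D Df {cov}; apply: finite_set_induct => [|B i [n nB]]; first by exists 0%N.
  case: i => [i|]; last by exists n => k [//|/nB].
  exists (maxn n i.+1) => k [[->]|/nB kn]; rewrite leq_max ?leqnn ?orbT //.
  by rewrite kn.
exists n0 => n n0n.
have sc : small (\bigcup_k clopen (b k) `\` clopen c) (e / 2).
  exists (\bigcup_k clopen (b k) `&` clopen (¬ c)); split.
  - by apply: (max_openI R) => //; apply/max_open_clopen/(boolean_neg R Mc cb).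
  - by rewrite max_clopen_neg.
  - move=> d db dO y; apply: cex => //; first by move=> m /dO[].
    by apply/mv_odot_eq0/(max_clopen_sub Mc db) => m /dO[].
have sb : small (\bigcup_k symdiff (A k) (clopen (b k))) (e / 2).
  by apply: small_bigcup => // k; have [] := bP k.
have := smallU sc sb; rewrite (_ : e / 2 + e / 2 = e); last by lra.
apply: smallS => // m [[k _ Am] nA].
have [bm|bm] := pselect (clopen (b k) m); last by right; exists k => //; left.
have [cm|cm] := pselect (clopen c m); last by left; split=> //; exists k.
have [[l|] Di Fm] := cov m Logic.I; last by case: Fm.
right; exists l => //; right; split=> // Al; apply: nA; exists l => //=.
exact: leq_trans (n0P _ Di) n0n.
Qed.

Lemma extension_bigcup (A : nat -> set (MaxSpec M)) e :
  (forall k, max_borel (A k)) -> trivIset setT A -> 0 < e ->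
  exists n0, forall n, (n0 <= n)%N ->
    forall y, `|\sum_(k < n) extension (A k) y - extension (\bigcup_k A k) y| <= e.
Proof.
move=> Ab At e0; have [n0 n0P] := small_tail Ab e0.
exists n0 => n /n0P small_n y.
have [||Ua Us] := @extension_sum A n y.
- by move=> k _; exact: approximable_borel.
- by move=> i j _ _; exact: At.
set U := \bigcup_(k in [set k | (k < n)%N]) A k in small_n Ua Us.
have Ta : approximable (\bigcup_k A k `\` U).
  apply: approximableD; last exact: Ua.
  apply: approximable_borel => S SP.
  by have [[_ _ SU] _] := SP; apply: SU => k; exact: Ab.
have UT : U `<=` \bigcup_k A k by move=> m [k _ Am]; exists k.
rewrite -Us -[X in _ - extension X y](setDUK UT) extensionU //; last first.
  by rewrite setDIK.
rewrite opprD addrA subrr add0r normrN ger0_norm ?extension_ge0 //.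
exact: extension_small.
Qed.

End Extension.

(** * Integration *)

Lemma max_compact_closed (M : mvalg) (K : set (MaxSpec M)) :
  max_open (~` K) -> max_compact K.
Proof.
move=> Ko I O Oo KO; pose F (i : option I) := if i is Some j then O j else ~` K.
have [[j|]|m _|D Df cov] := @max_spec_compact M _ F; [exact: Oo|exact: Ko|..].
  have [/KO[i _ Oi]|Km] := pselect (K m); [by exists (Some i)|by exists None].
exists (Some @^-1` D).
  by apply: finite_preimage => // i j _ _ [].
move=> m Km; have [[i|] Di Fm] := cov m Logic.I; last by case: Fm.
by exists i.
Qed.

Section Borel.
Variable M : mvalg.
Implicit Types A B : set (MaxSpec M).

Lemma max_borel_open A : max_open A -> max_borel A.
Proof. by move=> Ao S [_]; exact. Qed.

Lemma max_borelC A : max_borel A -> max_borel (~` A).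
Proof.
by move=> Ab S SP; have [[_ SC _] _] := SP; rewrite -setTD; apply: SC; exact: Ab.
Qed.

Lemma max_borel_bigcup (A : nat -> set (MaxSpec M)) :
  (forall k, max_borel (A k)) -> max_borel (\bigcup_k A k).
Proof. by move=> Ab S SP; have [[_ _ SU] _] := SP; apply: SU => k; exact: Ab. Qed.

Lemma max_borelU A B : max_borel A -> max_borel B -> max_borel (A `|` B).
Proof.
move=> Ab Bb; rewrite -bigcup2E; apply: max_borel_bigcup => -[|[|k]] //=.
by move=> S [[S0 _ _] _].
Qed.

Lemma max_borelD A B : max_borel A -> max_borel B -> max_borel (A `\` B).
Proof.
move=> Ab Bb; rewrite -[_ `\` _]setCK setCD setUC.
by apply: max_borelC; apply: max_borelU => //; exact: max_borelC.
Qed.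

End Borel.

Lemma state_oplus_odot (R : realType) (M : mvalg) (s : M -> R) (a b : M) : mv_state s ->
  s (a ⊕ b) + s (a ⊙ b) = s a + s b.
Proof.
move=> ss; rewrite (state_split ss (mv_le_oplusr a b)).
rewrite [s b](state_split ss (mv_odot_ler a b)) mv_neg_odot.
have -> : (a ⊕ b) ⊙ ¬ a = b ⊙ (¬ a ⊕ ¬ b); last by lra.
by rewrite mv_odotC [¬ a ⊕ _]mv_oplusC -mv_meet_odot mv_meetC mv_meet_odot mv_negK.
Qed.

Lemma star_simple_approx (R : realType) (M : mvalg) (a : M) :
  exists n c A, @simple_approx R M (mvstar R a) n c A.
Proof.
pose V (r : R) : set (MaxSpec M) := [set m | mvstar R a m < r].
pose A k i := V (i.+1%:R / k.+1%:R) `\` V (i%:R / k.+1%:R).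
have AE k i m : A k i m <-> i%:R <= k.+1%:R * mvstar R a m < i.+1%:R.
  have VE j : V (j%:R / k.+1%:R) m <-> k.+1%:R * mvstar R a m < j%:R.
    by rewrite /V /= ltr_pdivlMr ?ltr0n // mulrC.
  split=> [[/VE h1 h2]|/andP[h1 h2]].
    by rewrite h1 andbT leNgt; apply/negP => /VE.
  by split; [exact/VE|move=> /VE; rewrite ltNge h1].
(* Steps of width 1/(k+1) need k+2 levels, because the value 1 has a level of its own. *)
exists (fun k => k.+2), (fun k i => i%:R / k.+1%:R), A; split.
- by move=> k i _; apply: max_borelD; apply: max_borel_open; exact: max_open_lt.
- move=> k i j _ _ [m [/AE/andP[i1 i2] /AE/andP[j1 j2]]].
  have := le_lt_trans i1 j2; have := le_lt_trans j1 i2; rewrite !ltr_nat !ltnS.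
  by move=> ? ?; apply/eqP; rewrite eqn_leq; apply/andP.
- move=> e e0; exists (Num.bound e^-1) => k ek m.
  set x := mvstar R a m; pose z := k.+1%:R * x.
  have z0 : 0 <= z by rewrite mulr_ge0 ?ler0n //; exact: star_ge0.
  have /andP[zi zi'] := truncn_itv z0; set i := Num.truncn z in zi zi'.
  have ik : (i < k.+2)%N.
    rewrite ltnS -(ler_nat R); apply: le_trans zi _; rewrite /z ler_piMr ?ler0n //.
    exact: star_le1.
  rewrite /simple_fun (bigD1 (Ordinal ik)) //= big1 ?addr0 => [|j ji]; last first.
    case: asboolP => // /AE/andP[j1 j2]; exfalso; move/eqP: ji; apply; apply: val_inj => /=.
    have := le_lt_trans j1 zi'; have := le_lt_trans zi j2; rewrite !ltr_nat !ltnS.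
    by move=> ? ?; apply/eqP; rewrite eqn_leq; apply/andP.
  rewrite asboolT; last by apply/AE; rewrite zi.
  have ke : e^-1 < k.+1%:R.
    apply: lt_le_trans (archi_boundP _) _; first by rewrite invr_ge0 ltW.
    by rewrite ler_nat leqW.
  have k0 : 0 < k.+1%:R :> R by rewrite ltr0n.
  have -> : i%:R / k.+1%:R - x = (i%:R - z) / k.+1%:R.
    by rewrite mulrBl /z mulrAC divff ?mul1r // gt_eqF.
  rewrite normrM [`|_^-1|]gtr0_norm ?invr_gt0 // ler_pdivrMr //.
  have e1 : 1 <= e * k.+1%:R by rewrite mulrC -ler_pdivrMr // div1r ltW.
  apply: le_trans e1; rewrite ler_norml; move: zi'; rewrite -natr1 => ?.
  by apply/andP; split; lra.
Qed.

Section BinaryExpansion.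
Variables (R : realType) (M : mvalg) (Mc : mv_complete M).
Variables (Y : Type) (s : Y -> M -> R).
Hypothesis s_state : forall y, mv_state (s y).

(* The first binary digit of [a] is the Boolean element [b] and
   [c] is the doubled remainder. *)
Lemma star_halve (a : M) : exists b c, [/\ mv_boolean b,
  forall m, mvstar R a m = (mvstar R b m + mvstar R c m) / 2 &
  forall y, s y a = (s y b + s y c) / 2].
Proof.
have [|b [bb b1 b0]] := @boolean_separation R M Mc (a ⊙ a) (¬ a ⊙ ¬ a).
  move=> m; rewrite !starM !starN /Order.max.
  by minmax_cases; solve [left; lra | right; lra].
have bcase m : (mvstar R b m = 1 /\ 1 / 2 <= mvstar R a m) \/
    (mvstar R b m = 0 /\ mvstar R a m <= 1 / 2).
  case: (boolean_star R m bb) => bm; [right|left]; split=> //; rewrite leNgt; apply/negP => h.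
    have : mvstar R b m = 1 by apply: b1; rewrite starM; minmax_lra.
    by rewrite bm; lra.
  have : mvstar R b m = 0 by apply: b0; rewrite starM starN; minmax_lra.
  by rewrite bm; lra.
have ba : b ⊑ a ⊕ a.
  apply: (boolean_le (R := R)) => // m; rewrite /max_clopen /= starD => bm.
  by case: (bcase m) => -[bm']; [|rewrite bm' in bm]; minmax_lra.
(* Without truncation, [a ⊙ a] and [a ⊕ a] add up to 2a, for evaluations and for states alike;
   removing [b] from the second summand leaves 2a - b. *)
pose c := (a ⊙ a) ⊕ ((a ⊕ a) ⊙ ¬ b).
have disj : (a ⊙ a) ⊙ ((a ⊕ a) ⊙ ¬ b) = ⊥.
  apply: (star_inj Mc (R := R)) => m; rewrite !starM starD starN star0.
  have := star_le1 R a m; have := star_ge0 R a m.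
  by case: (bcase m) => -[-> ?]; minmax_lra.
exists b, c; split=> // [m|y].
  rewrite starD !starM starD starN.
  have := star_le1 R a m; have := star_ge0 R a m.
  by case: (bcase m) => -[-> ?]; minmax_lra.
rewrite /c stateD //; have := state_oplus_odot a a (s_state y).
by rewrite (state_split (s_state y) ba); lra.
Qed.

(** The same coefficients and Booleans serve the function [mvstar R a] and the numbers [s y a], with
    errors uniform in [m] and [y]; this reduces the integral formula to Boolean elements. *)
Lemma star_binary_expansion k (a : M) : exists b : nat -> M,
  [/\ forall i, mv_boolean (b i),
    forall m, `|mvstar R a m - \sum_(i < k) (2 ^+ i.+1)^-1 * mvstar R (b i) m| <= (2 ^+ k)^-1 &
    forall y, `|s y a - \sum_(i < k) (2 ^+ i.+1)^-1 * s y (b i)| <= (2 ^+ k)^-1].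
Proof.
elim: k a => [|k IH] a.
  exists (fun=> ⊥); split=> [i|m|y]; first exact: boolean0.
    by rewrite big_ord0 subr0 expr0 invr1 ger0_norm ?star_le1 ?star_ge0.
  by rewrite big_ord0 subr0 expr0 invr1 ger0_norm ?state_le1 ?state_ge0.
have [b0 [c [b0b ca sa]]] := star_halve a; have [b [bb cb sb]] := IH c.
exists (fun i => if i is j.+1 then b j else b0); split=> [[|i]//|m|y].
  rewrite big_ord_recl /= expr1 ca.
  under eq_bigr do rewrite /= /bump leq0n add1n exprS invfM -mulrA.
  rewrite -mulr_sumr exprS invfM; move: (cb m); rewrite !ler_norml.
  by set S := \sum_(_ < _) _ => /andP[? ?]; apply/andP; split; lra.
rewrite big_ord_recl /= expr1 sa.
under eq_bigr do rewrite /= /bump leq0n add1n exprS invfM -mulrA.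
rewrite -mulr_sumr exprS invfM; move: (sb y); rewrite !ler_norml.
by set S := \sum_(_ < _) _ => /andP[? ?]; apply/andP; split; lra.
Qed.

End BinaryExpansion.

Section Integral.
Variables (R : realType) (M : mvalg) (Mc : mv_complete M).
Variables (Y : Type) (s : Y -> M -> R).
Hypothesis s_state : forall y, mv_state (s y).
Hypothesis s_seq : forall y : nat -> Y, exists2 f : nat -> nat, injective f &
  forall a (e : R), 0 < e -> exists n, forall i j, (n <= i)%N -> (n <= j)%N ->
    `|s (y (f i)) a - s (y (f j)) a| < e.
Local Notation ext := (extension s).

(** The sets in [l] may overlap. Removing the head (c, A) splits [E] into [A ∩ E], with bound t - c
    for the rest, and [E \ A], with bound t; this avoids a common refinement. *)
Lemma extension_simple_le (l : seq (R * set (MaxSpec M))) (E : set (MaxSpec M)) (t : R) y :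
  max_borel E -> (forall q, List.In q l -> max_borel q.2) ->
  (forall m, E m -> \sum_(q <- l) (if `[< q.2 m >] then q.1 else 0) <= t) ->
  \sum_(q <- l) q.1 * ext (q.2 `&` E) y <= t * ext E y.
Proof.
have bor := approximable_borel Mc s_state s_seq.
elim: l E t => [|[c A] l IH] E t Eb lb lt_.
  rewrite big_nil; have [[m Em]|E0] := pselect (exists m, E m).
    have := lt_ m Em; rewrite big_nil => t0.
    by rewrite mulr_ge0 // (extension_ge0 Mc) //; exact: bor.
  suff -> : E = set0 by rewrite (extension0 Mc) // mulr0.
  by apply/seteqP; split=> // m Em; apply: E0; exists m.
have Ab : max_borel A by apply: (lb (c, A)); left.
have l'b q : List.In q l -> max_borel q.2 by move=> ql; apply: lb; right.
have E2b : max_borel (E `\` A) by exact: max_borelD.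
have E1b : max_borel (A `&` E).
  by rewrite setIC -setDD; exact: max_borelD.
have split_ext B : max_borel B -> ext (B `&` E) y =
    ext (B `&` (A `&` E)) y + ext (B `&` (E `\` A)) y.
  have DI (C D : set (MaxSpec M)) : max_borel C -> max_borel D -> max_borel (C `&` D).
    by move=> Cb Db; rewrite -setDD; apply: max_borelD => //; exact: max_borelD.
  move=> Bb; rewrite -(extensionU Mc) //; first last.
  - by apply/seteqP; split=> // m [[_ [Am _]] [_ [_ /(_ Am)]]].
  - by apply: bor; apply: DI.
  - by apply: bor; apply: DI.
  congr (ext _ y); rewrite -setIUr; congr (_ `&` _); apply/seteqP; split=> m.
    by have [?|?] := pselect (A m); [left|right].
  by move=> [[]|[]].
have IH1 := IH _ (t - c) E1b l'b _; have IH2 := IH _ t E2b l'b _.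
rewrite big_cons /= (split_ext _ Ab).
have -> : ext E y = ext (A `&` E) y + ext (E `\` A) y.
  by have := split_ext _ (max_borel_open (max_openT R M)); rewrite !setTI.
have -> : A `&` (A `&` E) = A `&` E by rewrite setIA setIid.
have -> : ext (A `&` (E `\` A)) y = 0.
  by rewrite setDIK (extension0 Mc).
have -> : \sum_(q <- l) q.1 * ext (q.2 `&` E) y =
    \sum_(q <- l) q.1 * ext (q.2 `&` (A `&` E)) y +
    \sum_(q <- l) q.1 * ext (q.2 `&` (E `\` A)) y.
  rewrite -big_split /=.
  elim: l l'b {IH IH1 IH2 lt_ lb} => [|q l IH] lb; first by rewrite !big_nil.
  rewrite !big_cons IH; last by move=> q' ?; apply: lb; right.
  by rewrite (split_ext q.2) ?mulrDr //; apply: lb; left.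
have : \sum_(q <- l) q.1 * ext (q.2 `&` (A `&` E)) y <= (t - c) * ext (A `&` E) y.
  apply: IH1 => m [Am Em]; have := lt_ m Em; rewrite big_cons /= asboolT //; lra.
have : \sum_(q <- l) q.1 * ext (q.2 `&` (E `\` A)) y <= t * ext (E `\` A) y.
  by apply: IH2 => m [Em Am]; have := lt_ m Em; rewrite big_cons /= asboolF // add0r.
lra.
Qed.

Lemma extension_simple_close n c A n' c' A' (d : R) y :
  (forall i, (i < n)%N -> max_borel (A i)) -> (forall i, (i < n')%N -> max_borel (A' i)) ->
  (forall m : MaxSpec M, simple_fun n c A m - simple_fun n' c' A' m <= d) ->
  \sum_(i < n) c i * ext (A i) y - \sum_(i < n') c' i * ext (A' i) y <= d.
Proof.
move=> Ab Ab' fd.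
pose l := [seq (c (val i), A (val i)) | i <- index_enum 'I_n] ++
          [seq (- c' (val i), A' (val i)) | i <- index_enum 'I_n'].
have le_l : \sum_(q <- l) q.1 * ext (q.2 `&` setT) y <= d * ext setT y.
  apply: extension_simple_le.
  - exact: (max_borel_open (max_openT R M)).
  - rewrite /l => q /List.in_app_iff[] /List.in_map_iff[i [<- _]] /=.
      exact: Ab.
    exact: Ab'.
  - move=> m _; rewrite big_cat !big_map /=; have := fd m; rewrite /simple_fun -sumrN.
    apply: le_trans; rewrite lerD2l; apply: ler_sum => i _.
    by case: asboolP => _; rewrite ?oppr0.
move: le_l; rewrite (extensionT Mc) // mulr1 big_cat !big_map /= -sumrN.
apply: le_trans; apply: lerD; apply: ler_sum => i _; rewrite setIT //.
by rewrite mulNr.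
Qed.

End Integral.

(** * The vector measure of a probability map *)

Lemma pow2_small (R : realType) (e : R) : 0 < e -> exists k, (2 ^+ k)^-1 <= e.
Proof.
move=> e0; exists (Num.bound e^-1); rewrite -[leRHS]invrK lef_pV2 ?posrE ?invr_gt0 ?exprn_gt0 //.
apply: ltW; apply: lt_trans (archi_boundP _) _; first by rewrite invr_ge0 ltW.
by rewrite -natrX ltr_nat ltn_expl.
Qed.

Section ExtensionIntegral.
Variables (R : realType) (M : mvalg) (Mc : mv_complete M).
Variables (Y : Type) (s : Y -> M -> R).
Hypothesis s_state : forall y, mv_state (s y).
Hypothesis s_seq : forall y : nat -> Y, exists2 f : nat -> nat, injective f &
  forall a (e : R), 0 < e -> exists n, forall i j, (n <= i)%N -> (n <= j)%N ->
    `|s (y (f i)) a - s (y (f j)) a| < e.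

Lemma extension_integral a n c A : @simple_approx R M (mvstar R a) n c A ->
  unif_cvg (fun k y => \sum_(i < n k) c k i * extension s (A k i) y) (fun y => s y a).
Proof.
move=> [Ab _ fa] e e0; have e4 : 0 < e / 4 by lra.
(* Both the given simple function and the binary expansion are within e/4 of [mvstar R a], so their
   integrals differ by at most e/2; a last e/4 leads to [s y a]. *)
have [l le4] := pow2_small e4; have [b [bb ab sb]] := star_binary_expansion Mc s_state l a.
have [k0 k0P] := fa _ e4; exists k0 => k /k0P {}fa y.
have bclopen i : (i < l)%N -> max_borel (max_clopen R (b i)).
  by move=> _; apply: max_borel_open; exact: max_open_clopen.
pose d i : R := (2 ^+ i.+1)^-1.
have dE m : simple_fun l d (fun i => max_clopen R (b i)) m =
    \sum_(i < l) d i * mvstar R (b i) m.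
  apply: eq_bigr => i _; rewrite (boolean_starE R m (bb i)).
  by case: asboolP; rewrite ?mulr1 ?mulr0.
have sE : \sum_(i < l) d i * extension s (max_clopen R (b i)) y =
    \sum_(i < l) d i * s y (b i).
  by apply: eq_bigr => i _; rewrite (extension_clopen Mc s_state).
have h1 := @extension_simple_close R M Mc Y s s_state s_seq (n k) (c k) (A k) l d
  (fun i => max_clopen R (b i)) (e / 2) y (Ab k) bclopen.
have h2 := @extension_simple_close R M Mc Y s s_state s_seq l d
  (fun i => max_clopen R (b i)) (n k) (c k) (A k) (e / 2) y bclopen (Ab k).
rewrite sE in h1 h2.
have {}h1 : \sum_(i < n k) c k i * extension s (A k i) y - \sum_(i < l) d i * s y (b i) <= e / 2.
  apply: h1 => m; rewrite dE; have := fa m; have := ab m.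
  by rewrite !ler_norml => /andP[? ?] /andP[? ?]; lra.
have {}h2 : \sum_(i < l) d i * s y (b i) - \sum_(i < n k) c k i * extension s (A k i) y <= e / 2.
  apply: h2 => m; rewrite dE; have := fa m; have := ab m.
  by rewrite !ler_norml => /andP[? ?] /andP[? ?]; lra.
have := sb y; rewrite -/(d _) !ler_norml => /andP[? ?]; apply/andP; split; lra.
Qed.

End ExtensionIntegral.

Section DualBall.
Variables (R : realType) (N : mvalg) (x : (MaxSpec N -> R) -> R).
Hypothesis xb : dual_unit_ball x.

(** The left side is [x] applied to the combination of the [f i] with signs ±1, whose absolute value
    is at most the sum of the nonnegative [f i]. This bounds the semivariation. *)
Lemma dual_unit_ball_sum_norm_le (n : nat) (f : nat -> MaxSpec N -> R) (d : R) :
  (forall i, (i < n)%N -> max_continuous (f i)) ->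
  (forall i y, (i < n)%N -> 0 <= f i y) -> (forall y, \sum_(i < n) f i y <= d) ->
  \sum_(i < n) `|x (f i)| <= d.
Proof.
move=> fc f0 fd; have [xD xZ xle] := xb.
pose sg i : R := if 0 <= x (f i) then 1 else -1.
pose g k (y : MaxSpec N) : R := \sum_(i < k) sg i * f i y.
have [gc gx] : max_continuous (g n) /\ x (g n) = \sum_(i < n) `|x (f i)|.
  elim: n fc {f0 fd} => [|n IH] fc.
    have g0 : g 0%N = fun=> 0 by apply/funext => y; rewrite /g big_ord0.
    rewrite g0 big_ord0; split; first exact: max_continuous0.
    apply/eqP; rewrite -normr_le0; apply: xle => [|y]; first exact: max_continuous0.
    by rewrite normr0.
  have [|gc gx] := IH; first by move=> i ni; apply: fc; exact: ltnW.
  have gS : g n.+1 = g n \+ (fun y => sg n * f n y).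
    by apply/funext => y; rewrite /g big_ord_recr.
  have fnc := fc n (ltnSn n); have sfc := max_continuousZ (sg n) fnc.
  rewrite gS; split; first exact: max_continuousD.
  rewrite xD // xZ // gx big_ord_recr /=; congr (_ + _).
  rewrite /sg; case: (lerP 0 (x (f n))) => x0; first by rewrite mul1r ger0_norm.
  by rewrite mulN1r ltr0_norm.
rewrite -gx; apply: le_trans (ler_norm _) _; apply: xle => // y.
apply: le_trans (fd y); apply: le_trans (ler_norm_sum _ _ _) _.
apply: ler_sum => i _; rewrite normrM [`|f i y|]ger0_norm ?f0 //.
by rewrite /sg; case: ifP => _; rewrite ?normrN normr1 mul1r.
Qed.

End DualBall.

Theorem theorem3p15 (R : realType) (M N : mvalg) :
  mv_complete M -> mv_semisimple N -> max_metrisable R N ->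
  forall p : M -> N, probability_map p ->
  exists mu : set (MaxSpec M) -> MaxSpec N -> R,
    [/\ vector_measure mu, regular_vm mu &
        forall a : M, is_vm_integral mu (mvstar R a) (mvstar R (p a))].
Proof.
move=> Mc _ Nm p pp.
pose s (y : MaxSpec N) (a : M) : R := mvstar R (p a) y.
have s_state y : mv_state (s y) by exact: probability_map_state.
have s_seq (y : nat -> MaxSpec N) : exists2 f : nat -> nat, injective f &
    forall a (e : R), 0 < e -> exists n, forall i j, (n <= i)%N -> (n <= j)%N ->
    `|s (y (f i)) a - s (y (f j)) a| < e.
  have [f f_inj fP] := metrisable_seq_cluster y Nm; exists f => // a e e0.
  by apply: fP => //; exact: star_continuous.
have bor := approximable_borel Mc s_state s_seq.
have mu_cont A : max_borel A -> max_continuous (extension s A).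
  move=> /bor Aa; apply/max_continuousP => y e e0.
  have e3 : 0 < e / 3 by lra.
  have [b Ab] := Aa _ e3.
  have /max_continuousP/(_ y _ e3)[V [Vo Vy Vb]] := @star_continuous R N (p b).
  exists V; split=> // z /Vb.
  have := extension_approx Mc s_state z Ab; have := extension_approx Mc s_state y Ab.
  rewrite !ler_norml !ltr_norml /s => /andP[? ?] /andP[? ?] /andP[? ?].
  by apply/andP; split; lra.
exists (extension s); split.
- split=> // A Ab At e e0.
  exact: (extension_bigcup Mc s_state s_seq Ab At e0).
- move=> A e Ab e0; have e2 : 0 < e / 2 by lra.
  have [b [bb [W [Wo AW We]]]] := bor A Ab _ e2.
  have bo := max_open_clopen R bb.
  (* [W] contains the symmetric difference of [A] and the clopen set of [b], so these sets enclose
     [A] and their difference lies in [W]. *)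
  exists (max_clopen R b `\` W), (max_clopen R b `|` W); split.
  + apply: max_compact_closed; rewrite setCD; apply: (max_openU R) => //.
    rewrite -max_clopen_neg //; by apply: max_open_clopen; exact: (boolean_neg R Mc bb).
  + exact: (max_openU R).
  + by move=> m [bm Wm]; apply: contrapT => Am; apply/Wm/AW; right.
  + move=> m Am; have [bm|bm] := pselect (max_clopen R b m); first by left.
    by right; apply: AW; left.
  + apply: (@le_lt_trans _ _ (e / 2)%:E); last by rewrite lte_fin; lra.
    apply: ge_ereal_sup => _ [x [xb ->]]; apply: ge_ereal_sup => _ [n [F [[Fb Ft FE] ->]]].
    rewrite lee_fin; apply: (dual_unit_ball_sum_norm_le xb (f := fun i => extension s (F i)))
      => [i ni|i y ni|y].
    * by apply: mu_cont; exact: Fb.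
    * by apply: (extension_ge0 Mc) => //; apply: bor; exact: Fb.
    * have [|_ <-] := @extension_sum R M Mc _ s s_state F n y _ Ft.
        by move=> i ni; apply: bor; exact: Fb.
      rewrite FE; apply: (extension_small Mc) => //; exists W; split=> //.
      by move=> m [[bm|//] nbW]; apply: contrapT => Wm; apply: nbW.
- move=> a; split; first exact: star_simple_approx.
  by move=> n c A /(extension_integral Mc s_state s_seq).
Qed.
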